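(* Suppose that $F:\mathbb{R}^d\to\mathbb{R}^d$ is affine linear, $\mathbb{X}\subset\mathbb{R}^d$ is a bounded polyhedron, and there is $\sigma>0$ such that $$\min_{x\in\overline{\mathbb{X}}_{(t)}\setminus\mathbb{X}^*_{(t)}}\psi_{(t)}(x)-\psi^*_{(t)}>\sigma\quad\text{for any }t\in[0,1].$$ Let $\{x^0,x^1,\ldots\}$ be the sequence produced by the homotopy continuation algorithm described in the context, and let $x^*$ be any cluster point of $\{x^0,x^1,\ldots\}$. Then $x^*$ is a solution of the variational inequality problem: $x^*\in\mathbb{X}$ and $\langle F(x^* ),x-x^*\rangle\ge0$ for all $x\in\mathbb{X}$.
   Context: Take a linear strongly monotone mapping $H$, say $H(x)=x$. For $t\in[0,1]$ put $F^{(t)}(x):=tH(x)+(1-t)F(x)$, and for a fixed $\lambda>0$ $$g^{(t)}_\lambda(x):=\max_{y\in\mathbb{X}}\left[\langle F^{(t)}(x),x-y\rangle-\tfrac{1}{2\lambda}\|x-y\|^2\right],\qquad\psi_{(t)}=g^{(t)}_\lambda+\mathcal{I}_{\mathbb{X}},$$ where $\mathcal{I}_{\mathbb{X}}$ is the indicator function of $\mathbb{X}$. $\overline{\mathbb{X}}_{(t)}$ and $\mathbb{X}^*_{(t)}$ are the sets of critical points ($0\in\partial\psi_{(t)}(x)=\nabla g_\lambda^{(t)}(x)+\mathcal{N}_{\mathbb{X}}(x)$, with $\mathcal{N}_{\mathbb{X}}$ the normal cone) and of global minimizers of $\psi_{(t)}$, and $\psi^*_{(t)}$ is its minimum value. A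 minimum over the empty set is $+\infty$. Algorithm (proximal gradient on gap function with homotopy continuation). Fix $\delta\in(0,1)$. Let $t^{(0)}=1$ and let $x^0\in\mathbb{X}$ be the solution of the strongly monotone variational inequality on $\mathbb{X}$ with mapping $F^{(t^{(0)})}$. For $k=0,1,\ldots$: (1) set $i:=1$; (2) let $t_i^{(k)}:=t^{(k)}(1-\delta^i)$; (3) apply the proximal gradient method to minimize $g^{(t_i^{(k)})}_\lambda$ over $\mathbb{X}$ starting from $x^k$, and let $x_i^k$ be the resulting solution (the limit of the method). The method iterates $$z^{j+1}=\arg\min_{z\in\mathbb{R}^d}\left[\langle\nabla g^{(t_i^{(k)})}_\lambda(z^j),z-z^j\rangle+\mathcal{I}_{\mathbb{X}}(z)+\tfrac{1}{2\alpha}\|z-z^j\|^2\right],$$ with stepsize $\alpha\in(0,1/L)$, $L$ being a Lipschitz constant of $\nabla g^{(t_i^{(k)})}_\lambda$; (4) if $g^{(t_i^{(k)})}_\lambda(x_i^k)=0$, set $x^{k+1}:=x_i^k$, $t^{(k+1)}:=t_i^{(k)}$, and proceed to $k+1$ (back to (1)); if $g^{(t_i^{(k)})}_\lambda(x_i^k)>0$, set $i:=i+1$ and go to (2). *)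

(* Defs.v *)
From HB Require Import structures.
From mathcomp Require Export all_boot all_order all_algebra.
From mathcomp Require Export all_classical all_reals all_analysis.
Export Order.TTheory GRing.Theory Num.Theory.
Export numFieldNormedType.Exports.

Set Implicit Arguments.
Unset Strict Implicit.
Unset Printing Implicit Defensive.

Local Open Scope classical_set_scope.
Local Open Scope ring_scope.

(* The library norm `|_| on 'rV[R]_d is the max norm, hence the explicit
   Euclidean structure below; both norms give the same topology and the same
   bounded sets, so those notions are taken from the library. *)
Definition dotv (R : realType) (d : nat) (u v : 'rV[R]_d) : R :=
  \sum_(i < d) u 0 i * v 0 i.

Definition enorm (R : realType) (d : nat) (u : 'rV[R]_d) : R :=
  Num.sqrt (dotv u u).

Definition polyhedron (R : realType) (d : nat) (X : set 'rV[R]_d) : Prop :=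
  exists (m : nat) (A : 'M[R]_(d, m)) (b : 'rV[R]_m),
    X = [set x | forall i : 'I_m, (x *m A) 0 i <= b 0 i].

Definition affine_linear (R : realType) (d : nat)
    (F : 'rV[R]_d -> 'rV[R]_d) : Prop :=
  exists (A : {linear 'rV[R]_d -> 'rV[R]_d}) (b : 'rV[R]_d),
    forall x, F x = A x + b.

Definition strongly_monotone (R : realType) (d : nat)
    (H : 'rV[R]_d -> 'rV[R]_d) : Prop :=
  exists2 mu : R, 0 < mu &
    forall x y, mu * enorm (x - y) ^+ 2 <= dotv (H x - H y) (x - y).

Definition VI_solution (R : realType) (d : nat) (F : 'rV[R]_d -> 'rV[R]_d)
    (X : set 'rV[R]_d) (x : 'rV[R]_d) : Prop :=
  X x /\ forall y, X y -> 0 <= dotv (F x) (y - x).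

Definition homotopy_map (R : realType) (d : nat)
    (H F : 'rV[R]_d -> 'rV[R]_d) (t : R) (x : 'rV[R]_d) : 'rV[R]_d :=
  t *: H x + (1 - t) *: F x.

(* [sup] is only used for X nonempty and compact, where the maximum over y is
   attained at the projection of x - lambda F(x) onto X. *)
Definition gap (R : realType) (d : nat) (lambda : R)
    (F : 'rV[R]_d -> 'rV[R]_d) (X : set 'rV[R]_d) (x : 'rV[R]_d) : R :=
  sup [set dotv (F x) (x - y) - (2 * lambda)^-1 * enorm (x - y) ^+ 2
      | y in X].

Definition indicator (R : realType) (d : nat) (X : set 'rV[R]_d)
    (x : 'rV[R]_d) : \bar R :=
  if x \in X then 0%E else +oo%E.

Definition gap_obj (R : realType) (d : nat) (g : 'rV[R]_d -> R)
    (X : set 'rV[R]_d) (x : 'rV[R]_d) : \bar R :=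
  ((g x)%:E + indicator X x)%E.

(* The vector of partial derivatives; it is the gradient wherever f is
   differentiable, which is everywhere for the gap function of an affine
   mapping. *)
Definition gradient (R : realType) (d : nat) (f : 'rV[R]_d -> R)
    (x : 'rV[R]_d) : 'rV[R]_d :=
  \row_(i < d) ('D_(delta_mx 0 i) f x).

(* Empty at the points outside X, by the usual convention. *)
Definition normal_cone (R : realType) (d : nat) (X : set 'rV[R]_d)
    (x : 'rV[R]_d) : set 'rV[R]_d :=
  [set v | X x /\ forall y, X y -> dotv v (y - x) <= 0].

Definition subdiff (R : realType) (d : nat) (g : 'rV[R]_d -> R)
    (X : set 'rV[R]_d) (x : 'rV[R]_d) : set 'rV[R]_d :=
  [set gradient g x + v | v in normal_cone X x].

Definition critical_points (R : realType) (d : nat) (g : 'rV[R]_d -> R)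
    (X : set 'rV[R]_d) : set 'rV[R]_d :=
  [set x | subdiff g X x 0].

Definition is_argmin (R : realType) (d : nat) (phi : 'rV[R]_d -> \bar R)
    (x : 'rV[R]_d) : Prop :=
  forall y, (phi x <= phi y)%E.

Definition global_minimizers (R : realType) (d : nat) (g : 'rV[R]_d -> R)
    (X : set 'rV[R]_d) : set 'rV[R]_d :=
  [set x | is_argmin (gap_obj g X) x].

Definition min_value (R : realType) (d : nat) (g : 'rV[R]_d -> R)
    (X : set 'rV[R]_d) : \bar R :=
  ereal_inf (range (gap_obj g X)).

(* [ereal_inf set0 = +oo], so the condition holds when every critical point
   is a global minimizer. *)
Definition critical_gap (R : realType) (d : nat) (sigma : R)
    (g : 'rV[R]_d -> R) (X : set 'rV[R]_d) : Prop :=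
  (sigma%:E <
   ereal_inf (gap_obj g X @` (critical_points g X `\` global_minimizers g X))
   - min_value g X)%E.

Definition lipschitz_const (R : realType) (d : nat) (L : R)
    (G : 'rV[R]_d -> 'rV[R]_d) : Prop :=
  forall x y, enorm (G x - G y) <= L * enorm (x - y).

Definition prox_grad_step (R : realType) (d : nat) (alpha : R)
    (g : 'rV[R]_d -> R) (X : set 'rV[R]_d) (z z' : 'rV[R]_d) : Prop :=
  is_argmin (fun w => (dotv (gradient g z) (w - z))%:E + indicator X w
                      + ((2 * alpha)^-1 * enorm (w - z) ^+ 2)%:E)%E z'.

(* [w] is the limit of the proximal gradient iterates started at [x], for
   some admissible stepsize. *)
Definition prox_grad_output (R : realType) (d : nat) (g : 'rV[R]_d -> R)
    (X : set 'rV[R]_d) (x w : 'rV[R]_d) : Prop :=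
  exists (L alpha : R) (z : nat -> 'rV[R]_d),
    [/\ 0 < L /\ lipschitz_const L (gradient g),
        0 < alpha < L^-1,
        z 0%N = x,
        forall j, prox_grad_step alpha g X (z j) (z j.+1)
      & z @ \oo --> w].

(* One outer iteration, from (x, t) to (x', t'): [w i] is the solution of the
   i-th trial, and the n-th trial is the first one to succeed. *)
Definition homotopy_step (R : realType) (d : nat) (lambda delta : R)
    (H F : 'rV[R]_d -> 'rV[R]_d) (X : set 'rV[R]_d)
    (x : 'rV[R]_d) (t : R) (x' : 'rV[R]_d) (t' : R) : Prop :=
  let g s := gap lambda (homotopy_map H F s) X in
  let tt i := t * (1 - delta ^+ i) in
  exists (n : nat) (w : nat -> 'rV[R]_d),
    [/\ (1 <= n)%N,
        forall i, (1 <= i <= n)%N -> prox_grad_output (g (tt i)) X x (w i),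
        forall i, (1 <= i < n)%N -> 0 < g (tt i) (w i),
        g (tt n) (w n) = 0
      & x' = w n /\ t' = tt n].

Definition homotopy_run (R : realType) (d : nat) (lambda delta : R)
    (H F : 'rV[R]_d -> 'rV[R]_d) (X : set 'rV[R]_d)
    (x : nat -> 'rV[R]_d) (t : nat -> R) : Prop :=
  [/\ t 0%N = 1,
      VI_solution (homotopy_map H F (t 0%N)) X (x 0%N)
    & forall k, homotopy_step lambda delta H F X (x k) (t k) (x k.+1) (t k.+1)].

(* Main.v *)
(* The iterates solve VI(F^(t_k)), so everything reduces to t_k -> 0.

   If x solves VI(F^(t)) then g^(s)(x) <= B |s - t| with B uniform on X. The
   proximal gradient method decreases g^(s) and its limits are critical, so
   by the sigma-gap a trial parameter s with B |s - t| <= sigma ends at a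
   global minimizer of psi_(s). A failed trial is thus impossible once
   B delta^i <= sigma, which bounds the number of trials and makes t_k decay
   geometrically -- provided that the minimum value of g^(s) is 0, i.e. that
   VI(F^(s)) has a solution, although F^(s) need not be monotone.

   A solution is a fixed point of the map sending x to the maximizer y(x) in
   the definition of the gap function. It is Lipschitz, and the required case
   of Brouwer's theorem is proved by Scarf's argument: a parity count over the
   points of a fine grid, ordered by each barycentric coordinate, replaces
   Sperner's lemma and needs no triangulation. *)

Require Import Defs.
From mathcomp Require Import zify ring lra.

Set Implicit Arguments.
Unset Strict Implicit.
Unset Printing Implicit Defensive.

(** As [Z] has one element more than its image, [f] identifies exactly one pair, and removing an
    element keeps the image exactly when it lies in that pair. This parity fact serves twice: for
    the doors of a room, with [f] the colouring, and for the rooms at a door, with [f] sending a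
    coordinate to the element minimal in it. *)
Lemma card_coincidence (A B : finType) (f : A -> B) (Z : {set A}) (V : {set B}) :
  #|Z| = #|V|.+1 -> f @: Z = V -> #|[set x in Z | f @: (Z :\ x) == V]| = 2.
Proof.
move=> cardZ fZ.
have /imset_injP Ninj : #|f @: Z| != #|Z| by rewrite fZ cardZ neq_ltn ltnSn.
have [x xZ [x' x'Z [xx' fxx']]] :
    exists2 x, x \in Z & exists2 x', x' \in Z & x != x' /\ f x = f x'.
  apply: contrapT => H; apply: Ninj => x y xZ yZ fxy.
  by apply/eqP/negPn/negP => xy; apply: H; exists x => //; exists y.
have fZx : f @: (Z :\ x) = V.
  apply/eqP; rewrite -fZ finset.eqEsubset imsetS ?subsetDl //=.
  apply/fintype.subsetP => _ /imsetP[y yZ ->].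
  have [->|yx] := eqVneq y x; first by rewrite fxx' imset_f // !inE eq_sym xx'.
  by rewrite imset_f // !inE yx.
have /imset_injP injx : #|f @: (Z :\ x)| == #|Z :\ x|.
  by rewrite fZx; move: (cardsD1 x Z); rewrite xZ cardZ add1n => -[->].
have fZx' : f @: (Z :\ x') = V.
  apply/eqP; rewrite -fZ finset.eqEsubset imsetS ?subsetDl //=.
  apply/fintype.subsetP => _ /imsetP[y yZ ->].
  have [->|yx] := eqVneq y x'; first by rewrite -fxx' imset_f // !inE xx'.
  by rewrite imset_f // !inE yx.
rewrite (_ : [set _ in _ | _] = [set x; x']) ?cards2 ?xx' //.
apply/setP => y; rewrite !inE.
apply/andP/orP => [[yZ /eqP fZy]|[/eqP->|/eqP->]]; rewrite ?xZ ?x'Z ?fZx ?fZx' //.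
have [->|yx] := eqVneq y x; first by left.
right; apply/eqP; have : f y \in f @: (Z :\ y) by rewrite fZy -fZ imset_f.
case/imsetP => w; rewrite !inE => /andP[wy wZ] fyw.
have [wx|wx] := eqVneq w x.
  by apply: injx; rewrite ?inE ?yx ?(eq_sym x') ?xx' // -fxx' -wx.
by case/eqP: wy; apply/esym/injx; rewrite ?inE ?yx ?wx.
Qed.

(** * Scarf's lemma *)

Section Scarf.
(* The [e i] play the part of Scarf's slack vectors: [e i] stands for the facet
   on which the i-th barycentric coordinate vanishes. *)
Variables (I Y : finType) (r : I -> Y -> nat) (c : Y -> I) (e : I -> Y).
Hypothesis r_inj : forall i, injective (r i).
Hypothesis ce : forall i, c (e i) = i.
Hypothesis re_min : forall i y, r i (e i) <= r i y.
Hypothesis re_max : forall i k y, k != i -> y \notin codom e -> r k y < r k (e i).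
Variable y0 : Y.
Hypothesis y0e : y0 \notin codom e.
Variable i0 : I.

(** Scarf's primitive sets, here of any size. They stand in for the simplices of a triangulation;
    subsets of dominant sets are again dominant. *)
Definition dominant (Z : {set Y}) : bool :=
  [forall y, exists i, forall z in Z, r i y <= r i z].

Definition above (i : I) (Z : {set Y}) (y : Y) : bool :=
  [exists z in Z, r i z < r i y].

(** Rooms correspond to top-dimensional simplices, doors to facets carrying all colours but [i0]. *)
Definition room (Z : {set Y}) : bool := dominant Z && (#|Z| == #|I|).

Definition door (W : {set Y}) : bool :=
  [&& dominant W, c @: W == [set~ i0] & #|W|.+1 == #|I|].

(* The only door on the boundary, i.e. contained in a single room. *)
Let W0 : {set Y} := e @: [set~ i0].

Lemma dominantP (Z : {set Y}) :
  reflect (forall y, exists i, ~~ above i Z y) (dominant Z).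
Proof.
apply: (iffP forallP) => H y.
  have /existsP[i /forall_inP Hi] := H y; exists i.
  by apply/exists_inPn => z /Hi; rewrite -leqNgt.
have [i /exists_inPn Hi] := H y; apply/existsP; exists i.
by apply/forall_inP => z /Hi; rewrite -leqNgt.
Qed.

Lemma dominantS (Z W : {set Y}) : W \subset Z -> dominant Z -> dominant W.
Proof.
move=> /fintype.subsetP WZ /dominantP H; apply/dominantP => y; have [i Hi] := H y.
by exists i; apply: contra Hi => /exists_inP[z /WZ zZ zy]; apply/exists_inP; exists z.
Qed.

Lemma above_antisym i (Z : {set Y}) y z :
  y \in Z -> z \in Z -> ~~ above i Z y -> ~~ above i Z z -> y = z.
Proof.
move=> yZ zZ /exists_inPn Hy /exists_inPn Hz; apply: (@r_inj i).
by apply/eqP; rewrite eqn_leq; apply/andP; split; rewrite leqNgt ?Hy ?Hz.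
Qed.

Lemma exists_min i (Z : {set Y}) z : z \in Z -> exists2 y, y \in Z & ~~ above i Z y.
Proof.
move=> zZ; case: (arg_minnP (r i) zZ) => y yZ Hy; exists y => //.
by apply/exists_inPn => w /Hy; rewrite -leqNgt.
Qed.

Lemma e_inj : injective e.
Proof. by move=> i j /(congr1 c); rewrite !ce. Qed.

(** A slack [e i] is lowest in coordinate [i], and any other point is below all of [W0] in
    coordinate [i0], so nothing lies above [W0] in every coordinate. *)
Lemma door_W0 : door W0.
Proof.
apply/and3P; split.
- apply/forallP => y; have [/codomP[i ->]|ye] := boolP (y \in codom e).
    by apply/existsP; exists i; apply/forall_inP => z _.
  apply/existsP; exists i0; apply/forall_inP => _ /imsetP[j + ->].
  by rewrite !inE eq_sym => /re_max /(_ ye) /ltnW.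
- by rewrite -imset_comp (eq_imset (g := id)) ?imset_id // => i; exact: ce.
- by rewrite card_imset ?cardsC1; [rewrite prednK //; apply/card_gt0P; exists i0|exact: e_inj].
Qed.

(** On slacks [c] inverts [e], so a door made of slacks is determined by its colours. *)
Lemma door_slack W : door W -> W \subset codom e -> W = W0.
Proof.
move=> /and3P[_ /eqP cW _] /fintype.subsetP We; apply/setP => y; apply/idP/idP.
  move=> yW; have /codomP[i yi] := We _ yW.
  by rewrite yi imset_f // -cW -(ce i) -yi imset_f.
case/imsetP => i; rewrite -cW => /imsetP[w wW ->] ->.
by have /codomP[j wj] := We _ wW; rewrite wj ce -wj.
Qed.

(** A door in [Z] is [Z] minus one element. If there is one, then [Z] has exactly the colours other
    than [i0], since it is not rainbow, and [card_coincidence] yields two doors. *)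
Lemma card_doors Z : room Z -> c @: Z != [set: I] ->
  2 %| #|[set W | door W & W \subset Z]|.
Proof.
case/andP=> domZ /eqP cardZ cZ.
set D := [set z in Z | c @: (Z :\ z) == [set~ i0]].
have -> : [set W | door W & W \subset Z] = (fun z => Z :\ z) @: D.
  apply/setP => W; rewrite !inE; apply/andP/imsetP.
    case=> /and3P[domW cW /eqP cardW] WZ.
    have : #|Z :\: W| == 1.
      by have := cardsD Z W; rewrite (finset.setIidPr WZ) cardZ -cardW subSnn => ->.
    case/cards1P => z Ez; have WE : W = Z :\ z.
      by rewrite -Ez finset.setDDr finset.setDv finset.set0U (finset.setIidPr WZ).
    exists z => //; rewrite inE -WE cW andbT.
    by have : z \in Z :\: W; [rewrite Ez set11|rewrite inE => /andP[]].
  case=> z; rewrite inE => /andP[zZ cZz] ->; rewrite subsetDl; split=> //.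
  apply/and3P; split=> //; first exact: dominantS (subsetDl _ _) domZ.
  by rewrite -cardZ (cardsD1 z Z) zZ.
rewrite card_in_imset; last first.
  move=> y z; rewrite !inE => /andP[yZ _] /andP[zZ _] /setP/(_ y).
  by rewrite !inE eqxx yZ andbT /=; case: eqP.
have [->|[z zD]] := set_0Vmem D; first by rewrite cards0.
have cZ' : c @: Z = [set~ i0].
  move: zD; rewrite inE => /andP[zZ /eqP cZz].
  rewrite -(finset.setD1K zZ) imsetU1 cZz; apply/finset.setUidPr; rewrite finset.sub1set !inE.
  apply: contra cZ => /eqP cz; rewrite -(finset.setD1K zZ) imsetU1 cZz cz.
  by apply/eqP/setP => i; rewrite !inE orbN.
rewrite card_coincidence // cardsC1 prednK //.
by apply/card_gt0P; exists i0.
Qed.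

Section Rooms.
Variable W : {set Y}.
Hypothesis doorW : door W.

(* Indices without which W still consists of minima; a room around W arises
   by adding the highest element of [candidates i] for such an i. *)
Let spare : {set I} :=
  [set i | [forall z in W, exists k, (k != i) && ~~ above k W z]].
Let candidates (i : I) : {set Y} :=
  [set y | [forall k, (k != i) ==> above k W y]].
Let usable : {set I} := [set i in spare | candidates i != finset.set0].
Let new (i : I) : Y :=
  odflt y0 [pick y in candidates i | [forall z in candidates i, r i z <= r i y]].

Let newP i : i \in usable ->
  new i \in candidates i /\ forall y, y \in candidates i -> r i y <= r i (new i).
Proof.
rewrite inE => /andP[_ /set0Pn[y yM]]; rewrite /new; case: pickP => /=.
  by move=> z /andP[zM /forall_inP].
case: (arg_maxnP (r i) yM) => z zM zmax /(_ z); rewrite [_ \in _]zM /=.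
by move/negP; case; apply/forall_inP => w /zmax.
Qed.

Let domW : dominant W. Proof. by case/and3P: doorW. Qed.

Lemma candidates_notin i y : i \in spare -> y \in candidates i -> y \notin W.
Proof.
rewrite inE => /forall_inP iK; rewrite inE => /forallP yM; apply/negP => /iK.
by case/existsP => k /andP[ki]; rewrite (implyP (yM k) ki).
Qed.

(** A candidate [y] is blocked in coordinate [i]: by maximality it is not above [new i], and as it
    is above [W] in every other coordinate, dominance of [W] acts there. A non-candidate is blocked
    by [W] in some coordinate [k != i], where [new i] is above the minimum of [W]. *)
Lemma dominant_new i : i \in usable -> dominant (new i |: W).
Proof.
move=> iU; have [/[!inE] /forallP nM nmax] := newP iU.
apply/dominantP => y; have [yM|] := boolP (y \in candidates i).
  exists i; apply/exists_inPn => z; rewrite !inE => /orP[/eqP->|zW].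
    by rewrite -leqNgt nmax.
  have /dominantP/(_ y)[k yk] := domW.
  have [ki|ki] := eqVneq k i; first by rewrite ki in yk; move/exists_inPn: yk; apply.
  by move: yM; rewrite inE => /forallP/(_ k); rewrite ki (negbTE yk).
rewrite inE negb_forall => /existsP[k]; rewrite negb_imply => /andP[ki yk].
exists k; apply/exists_inPn => z; rewrite !inE => /orP[/eqP->|zW]; last first.
  by move/exists_inPn: yk; apply.
have := implyP (nM k) ki => /exists_inP[w wW wn].
by move/exists_inPn: yk => /(_ w wW); rewrite -!leqNgt => /leq_trans; apply; exact: ltnW.
Qed.

Lemma new_inj : {in usable &, injective new}.
Proof.
move=> i j iU jU nij; apply/eqP/negPn/negP => ij.
have [/[!inE] /forallP iM _] := newP iU; have [/[!inE] /forallP jM _] := newP jU.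
have /dominantP/(_ (new i))[k /negP] := domW; apply.
have [ki|ki] := eqVneq k i; first by rewrite nij (implyP (jM k)) // ki.
exact: (implyP (iM k)).
Qed.

(** The index [i] is the one in which [y] is minimal in [y |: W]. Minima map [I] onto [y |: W],
    hence bijectively, so in all other coordinates the minimum lies in [W] and [y] is a candidate.
    Dominance of [y |: W] forbids [new i] from being higher than [y] in coordinate [i]. *)
Lemma new_surj y : y \notin W -> dominant (y |: W) -> exists2 i, i \in usable & y = new i.
Proof.
move=> yW domyW.
have /dominantP/(_ y)[i yi] := domyW.
have cardW : #|y |: W| = #|I| by rewrite cardsU1 yW; case/and3P: doorW => _ _ /eqP.
pose mn k : Y := odflt y0 [pick z in y |: W | ~~ above k (y |: W) z].
have mnP k : mn k \in y |: W /\ ~~ above k (y |: W) (mn k).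
  rewrite /mn; case: pickP => [z /andP[] //|/= H].
  by have [z zW zk] := exists_min k (setU11 y W); have := H z; rewrite zW zk.
have mnT : mn @: [set: I] = y |: W.
  apply/setP => z; apply/imsetP/idP => [[k _ ->]|zW]; first by case: (mnP k).
  have /dominantP/(_ z)[k zk] := domyW; exists k => //.
  by have [? ?] := mnP k; apply: above_antisym zk _.
have /imset_injP mn_inj : #|mn @: [set: I]| == #|[set: I]| by rewrite mnT cardW cardsT.
have mni : mn i = y by have [? ?] := mnP i; apply: above_antisym yi; rewrite ?setU11.
have yM : y \in candidates i.
  rewrite inE; apply/forallP => k; apply/implyP => ki; apply/exists_inP.
  have [] := mnP k; rewrite !inE => /orP[/eqP mnk|mnkW /exists_inPn mnk].
    by case/eqP: ki; apply: mn_inj; rewrite ?inE // mnk.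
  exists (mn k) => //; rewrite ltn_neqAle leqNgt mnk ?setU11 // andbT.
  by apply: contra yW => /eqP/r_inj <-.
have iU : i \in usable.
  rewrite !inE; apply/andP; split; last by apply/set0Pn; exists y.
  apply/forall_inP => z zW; have zyW : z \in y |: W by rewrite !inE zW orbT.
  have /imsetP[k _ zk] : z \in mn @: [set: I] by rewrite mnT.
  apply/existsP; exists k; apply/andP; split.
    by apply: contraNneq yW => ki; rewrite -mni -ki -zk.
  have [_] := mnP k; rewrite -zk; apply: contra => /exists_inP[w wW wz].
  by apply/exists_inP; exists w => //; rewrite !inE wW orbT.
exists i => //; have [nM nmax] := newP iU; apply: (@r_inj i); apply/eqP.
rewrite eqn_leq nmax //=; have /dominantP/(_ (new i))[k nk] := domyW.
have [ki|ki] := eqVneq k i.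
  by rewrite ki in nk; move/exists_inPn: nk => /(_ y (setU11 _ _)); rewrite -leqNgt.
case/negP: nk; move: nM; rewrite inE => /forallP/(_ k)/implyP/(_ ki)/exists_inP[w wW wn].
by apply/exists_inP; exists w => //; rewrite !inE wW orbT.
Qed.

Lemma card_rooms_usable : #|[set Z | room Z & W \subset Z]| = #|usable|.
Proof.
rewrite -(card_in_imset new_inj).
rewrite -(@card_in_imset _ _ (fun y => y |: W)); last first.
  move=> y z /imsetP[i + ->] /imsetP[j + ->] => iU jU /setP/(_ (new i)).
  have notinW k : k \in usable -> new k \notin W.
    move=> kU; have [kM _] := newP kU; apply: candidates_notin kM.
    by move: kU; rewrite inE => /andP[].
  by rewrite !inE eqxx (negbTE (notinW _ iU)) orbF /=; case: eqP.
apply: eq_card => Z; rewrite inE; apply/andP/imsetP.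
  case=> /andP[domZ /eqP cardZ] WZ.
  have : #|Z :\: W| == 1.
    have := cardsD Z W; rewrite (finset.setIidPr WZ) cardZ.
    by case/and3P: doorW => _ _ /eqP <-; rewrite subSnn => ->.
  case/cards1P => y Ey; have ZE : Z = y |: W.
    by rewrite -Ey finset.setUC; apply/esym/eqP; rewrite -{2}(setID Z W) (finset.setIidPr WZ).
  have yW : y \notin W by have : y \in Z :\: W; [rewrite Ey set11|rewrite inE => /andP[]].
  rewrite ZE in domZ *; have [i iU ->] := new_surj yW domZ.
  by exists (new i) => //; apply: imset_f.
case=> _ /imsetP[i iU ->] ->; rewrite finset.subsetUr; split=> //.
rewrite /room dominant_new //= cardsU1.
have [nM _] := newP iU; rewrite (candidates_notin _ nM) ?add1n; first by case/and3P: doorW.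
by move: iU; rewrite inE => /andP[].
Qed.

(** The minima map [I] onto [W], which is smaller by one, so exactly one element of [W] is minimal
    in two coordinates; either of these two can be spared. *)
Lemma card_spare : W != finset.set0 -> #|spare| = 2.
Proof.
case/set0Pn => w wW.
pose mn k : Y := odflt y0 [pick z in W | ~~ above k W z].
have mnP k : mn k \in W /\ ~~ above k W (mn k).
  rewrite /mn; case: pickP => [z /andP[] //|/= H].
  by have [z zW zk] := exists_min k wW; have := H z; rewrite zW zk.
have mnE k z : z \in W -> ~~ above k W z -> z = mn k.
  by move=> zW zk; have [? ?] := mnP k; apply: above_antisym zk _.
have mnT : mn @: [set: I] = W.
  apply/setP => z; apply/imsetP/idP => [[k _ ->]|zW]; first by case: (mnP k).
  by have /dominantP/(_ z)[k zk] := domW; exists k => //; exact: mnE.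
have cardW : #|[set: I]| = #|W|.+1 by case/and3P: doorW => _ _ /eqP ->; rewrite cardsT.
rewrite -(card_coincidence cardW mnT); apply: eq_card => i; rewrite !inE /=.
apply/forall_inP/eqP => H.
  apply/setP => z; apply/imsetP/idP => [[k _ ->]|zW]; first by case: (mnP k).
  have /existsP[k /andP[ki zk]] := H z zW; exists k; rewrite ?inE ?ki //; exact: mnE.
move=> z; rewrite -{1}H => /imsetP[k]; rewrite !inE andbT => ki ->.
by apply/existsP; exists k; rewrite ki; case: (mnP k).
Qed.

(** An element of [W] that is not a slack lies below [e i] in all coordinates but [i], so [e i] is a
    candidate and both spare indices are usable. *)
Lemma card_rooms : W != W0 -> #|[set Z | room Z & W \subset Z]| = 2.
Proof.
move=> WW0; have /subsetPn[z zW ze] : ~~ (W \subset codom e).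
  by apply: contra WW0 => /(door_slack doorW) ->.
rewrite card_rooms_usable -card_spare; last by apply/set0Pn; exists z.
apply: eq_card => i; rewrite [LHS]inE; apply/andP/idP => [[] //|iK]; split=> //.
apply/set0Pn; exists (e i); rewrite inE; apply/forallP => k; apply/implyP => ki.
by apply/exists_inP; exists z => //; exact: re_max.
Qed.

(** For [i0] the point [y0] is a candidate. For another spare [i], a candidate exceeds a slack of
    [W0] in coordinate [i0], so it is itself a slack and must be [e i]; but [e i] already belongs to
    [W0]. *)
Lemma card_rooms_slack : W = W0 -> #|[set Z | room Z & W \subset Z]| = 1.
Proof.
move=> WE; rewrite card_rooms_usable; apply/eqP/cards1P; exists i0.
have eW j : j != i0 -> e j \in W by move=> j0; rewrite WE imset_f // !inE.
apply/setP => i; rewrite !inE; apply/andP/eqP => [[/forall_inP iK /set0Pn[y]]|->].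
  rewrite inE => /forallP yM; apply/eqP/negPn/negP => ii0.
  have := implyP (yM i0); rewrite eq_sym => /(_ ii0)/exists_inP[z].
  rewrite WE => /imsetP[j]; rewrite !inE => ji0 -> zy.
  have /codomP[l yl] : y \in codom e.
    apply/negPn/negP => ye; have := re_max (i := j) (k := i0).
    by rewrite eq_sym => /(_ _ ji0 ye); rewrite ltnNge (ltnW zy).
  have li : l = i.
    apply/eqP/negPn/negP => li; have := implyP (yM l) li => /exists_inP[w _].
    by rewrite yl ltnNge re_min.
  have /existsP[k /andP[ki]] := iK _ (eW _ ii0); rewrite -li -yl.
  by rewrite (implyP (yM k) ki).
split.
  apply/forall_inP => z; rewrite WE => /imsetP[j]; rewrite !inE => j0 ->.
  apply/existsP; exists j; rewrite j0; apply/exists_inPn => w _.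
  by rewrite -leqNgt re_min.
apply/set0Pn; exists y0; rewrite inE; apply/forallP => k; apply/implyP => k0.
apply/exists_inP; exists (e k); first exact: eW.
rewrite ltn_neqAle re_min andbT; apply: contra y0e => /eqP/r_inj <-.
exact: codom_f.
Qed.
End Rooms.

(** Incident pairs of a room and a door are counted modulo 2. Without a rainbow room each room
    contributes an even number, whereas each door contributes 2 except [W0], which contributes 1. *)
Lemma exists_rainbow_dominant : exists2 Z : {set Y}, dominant Z & c @: Z = [set: I].
Proof.
apply: contrapT => H.
have even_doors Z : room Z -> 2 %| #|[set W | door W & W \subset Z]|.
  move=> roomZ; apply: card_doors => //; apply/negP => /eqP cZ; apply: H.
  by exists Z => //; case/andP: roomZ.
have cardE (P : pred {set Y}) (Q : {set Y} -> {set Y} -> bool) A :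
    #|[set B | P B & Q A B]| = \sum_(B | P B) Q A B.
  rewrite -sum1dep_card [RHS]big_mkcond /= big_mkcond /=.
  by apply: eq_bigr => B _; case: (P B); case: (Q A B).
have : 2 %| \sum_(Z | room Z) #|[set W | door W & W \subset Z]|.
  by apply: dvdn_sum => Z; exact: even_doors.
under eq_bigr do rewrite (cardE door (fun Z W => W \subset Z)).
rewrite exchange_big /= (bigD1 W0) ?door_W0 //=.
rewrite -(cardE room (fun W Z => W \subset Z)) card_rooms_slack ?door_W0 // dvdn_addl //.
apply: dvdn_sum => W /andP[doorW WW0].
by rewrite -(cardE room (fun W Z => W \subset Z)) card_rooms.
Qed.
End Scarf.

(** * Small cells among the lattice points of a simplex *)

Section Grid.
Variables (I : finType) (N : nat).

Definition grid : predArgType :=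
  {a : {ffun I -> 'I_N.+1} | \sum_i (a i : nat) == N}.

(** Coordinates of grid points are shifted into the range from 1 to [N.+1], leaving 0 and [N.+2] as
    strict extremes for the slacks. *)
Definition grid_coord (i : I) (z : grid + I) : nat :=
  match z with inl a => (val a i).+1 | inr j => if j == i then 0 else N.+2 end.

(** The enumeration index breaks ties, making the rank injective without disturbing strict
    inequalities between coordinates. *)
Definition grid_rank (i : I) (z : grid + I) : nat :=
  grid_coord i z * #|{: grid + I}| + enum_rank z.

Lemma grid_rank_lt i z z' :
  grid_coord i z < grid_coord i z' -> grid_rank i z < grid_rank i z'.
Proof.
move=> zz'; rewrite /grid_rank; have := ltn_ord (enum_rank z).
set n := #|_|; set k : nat := enum_rank z; move: zz'; nia.
Qed.

Lemma grid_rank_inj i : injective (grid_rank i).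
Proof.
move=> z z' /(congr1 (modn^~ #|{: grid + I}|)); rewrite /grid_rank !modnMDl.
by rewrite !modn_small // => /ord_inj/enum_rank_inj.
Qed.

Lemma grid_pointP (i1 : I) (b : I -> nat) : \sum_i b i <= N ->
  exists a : grid, forall i, b i <= val a i.
Proof.
(* The whole deficit is put on coordinate [i1]. *)
move=> bN; pose b' i := b i + (i == i1) * (N - \sum_i b i).
have sb' : \sum_i b' i = N.
  have s1 : \sum_i (i == i1 : nat) = 1.
    by rewrite (bigD1 i1) //= eqxx big1 // => i /negbTE ->.
  by rewrite big_split /= -big_distrl /= s1 mul1n subnKC.
have b'N i : b' i < N.+1 by rewrite ltnS -sb' (bigD1 i) //= leq_addr.
have sa : \sum_i ([ffun i => Ordinal (b'N i)] i : nat) == N.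
  by rewrite -[X in _ == X]sb'; apply/eqP/eq_bigr => i _; rewrite ffunE.
exists (exist (fun a : {ffun I -> 'I_N.+1} => \sum_i (a i : nat) == N) _ sa) => i.
by rewrite /= ffunE leq_addr.
Qed.

(** [S] consists of the grid points in a rainbow dominant set, a slack being coloured by its index.
    A colour is missing from [S] only if it comes from a slack, and then [S] lies close to the
    corresponding facet. *)
Lemma exists_small_cell (c : grid -> I) (i1 : I) : exists S : {set grid},
  [/\ S != finset.set0,
      forall a b, a \in S -> b \in S -> forall i, val a i <= val b i + #|I|
    & forall i, (exists2 a, a \in S & c a = i) \/
                (forall a, a \in S -> val a i <= #|I|)].
Proof.
pose c' (z : grid + I) := match z with inl a => c a | inr j => j end.
have [a0 _] := @grid_pointP i1 (fun=> 0) (leq_trans (eq_leq (big1_eq _ _)) (leq0n _)).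
have a0e : inl a0 \notin codom (@inr grid I) by apply/codomP => -[].
have [] := @exists_rainbow_dominant _ _ grid_rank c' inr grid_rank_inj _ _ _ _ a0e i1.
- by [].
- move=> i z; have [->//|] := eqVneq z (inr i); case: z => [a _|j ji].
    by apply/ltnW/grid_rank_lt; rewrite /= eqxx.
  by apply/ltnW/grid_rank_lt; rewrite /= eqxx; case: ifP => // /eqP jE; rewrite jE eqxx in ji.
- move=> i k [a|j] ki; last by rewrite codom_f.
  by move=> _; apply: grid_rank_lt => /=; rewrite eq_sym (negbTE ki) !ltnS leq_ord.
move=> Z domZ cZ.
(* The coordinate blocking a grid point cannot be one whose slack is in [Z], since that slack has
   value 0 there. *)
have domZP (a : grid) : exists i, inr i \notin Z /\
    forall z, z \in Z -> grid_rank i (inl a) <= grid_rank i z.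
  move/forallP: domZ => /(_ (inl a))/existsP[i /forall_inP Hi]; exists i; split=> //.
  apply/negP => /Hi; rewrite leqNgt => /negP; apply.
  by apply: grid_rank_lt; rewrite /= eqxx.
pose S := [set a | inl a \in Z].
have colour i : inr i \notin Z -> exists2 a, a \in S & c a = i.
  move=> iZ; have /imsetP[[a|j] zZ ij] : i \in c' @: Z by rewrite cZ.
    by exists a; rewrite ?inE.
  by rewrite ij /= zZ in iZ.
have [i2 [i2Z _]] := domZP a0; have [s0 s0S _] := colour i2 i2Z.
pose low i := [arg min_(a < s0 in S) (val a i : nat)].
have lowS i : low i \in S by rewrite /low; case: arg_minnP.
have low_le i a : a \in S -> val (low i) i <= val a i.
  by rewrite /low; case: arg_minnP => // b _ H /H.
pose C := [set i | inr i \notin Z].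
(* Otherwise the values [low i] for [i] in [C], each raised by one, still sum to at most [N], and a
   grid point dominating them contradicts [domZP]. *)
have sum_low : N < \sum_(i in C) val (low i) i + #|I|.
  rewrite ltnNge; apply/negP => H.
  have /(grid_pointP i1)[a Ha] :
      \sum_i (if i \in C then (val (low i) i).+1 else 0) <= N.
    rewrite -big_mkcond /=; under eq_bigr do rewrite -addn1; rewrite big_split /=.
    by rewrite (leq_trans _ H) // leq_add2l sum1_card max_card.
  have [i [iZ /(_ (inl (low i)))]] := domZP a.
  rewrite -[inl _ \in Z](finset.in_set (fun a => inl a \in Z)) -/S lowS => /(_ isT).
  rewrite leqNgt => /negP; apply; apply: grid_rank_lt => /=.
  by have := Ha i; rewrite inE iZ.
have sumC (a : grid) : \sum_(i in C) val a i + \sum_(i in ~: C) val a i = N.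
  rewrite -[RHS](eqP (valP a)) [RHS](bigID (mem C)) /=; congr addn.
  by apply: eq_bigl => i; rewrite inE.
exists S; split.
- by apply/set0Pn; exists s0.
(* The excess of [a] over the minima on [C], together with its coordinates outside [C], totals [N]
   minus the sum of the minima, which is below [#|I|] by [sum_low]. *)
- move=> a b aS bS i; have [iC|iC] := boolP (i \in C).
    apply: leq_trans (leq_add (low_le i b bS) (leqnn _)).
    have sumCi (F : I -> nat) :
      \sum_(j in C) F j = F i + \sum_(j in C | j != i) F j by rewrite (bigD1 i).
    have := sumC a; move: sum_low; rewrite !sumCi.
    have : \sum_(j in C | j != i) val (low j) j <= \sum_(j in C | j != i) val a j.
      by apply: leq_sum => j _; exact: low_le.
    move: (val a i : nat) (val (low i) i : nat) #|I|.
    by move: (\sum_(_ in C | _) _) (\sum_(_ in C | _) _) (\sum_(_ in ~: C) _); lia.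
  apply: leq_trans (leq_addl _ _); have := sumC a.
  have : \sum_(j in C) val (low j) j <= \sum_(j in C) val a j.
    by apply: leq_sum => j _; exact: low_le.
  have iC' : i \in ~: C by rewrite finset.in_setC.
  rewrite [X in _ + X](bigD1 i iC') /=; move: sum_low.
  move: (val a i : nat) #|I|.
  by move: (\sum_(_ in C) _) (\sum_(_ in C) _) (\sum_(_ in ~: C | _) _); lia.
- move=> i; have [iC|iC] := boolP (i \in C); [left|right].
    by apply: colour; rewrite inE in iC.
  move=> a aS; have := sumC a.
  have : \sum_(j in C) val (low j) j <= \sum_(j in C) val a j.
    by apply: leq_sum => j _; exact: low_le.
  have iC' : i \in ~: C by rewrite finset.in_setC.
  rewrite [X in _ + X](bigD1 i iC') /=; move: sum_low.
  move: (val a i : nat) #|I|.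
  by move: (\sum_(_ in C) _) (\sum_(_ in C) _) (\sum_(_ in ~: C | _) _); lia.
Qed.
End Grid.

Local Open Scope classical_set_scope.
Local Open Scope ring_scope.

(** * Fixed points of Lipschitz maps *)

Lemma coord_le_norm (R : realType) d (u : 'rV[R]_d) i : `|u 0 i| <= `|u|.
Proof.
rewrite [leRHS]/Num.norm /= mx_normrE.
by apply/bigmax_geP; right => /=; exists (0, i).
Qed.

Lemma norm_le_coord (R : realType) d (u : 'rV[R]_d) (c : R) :
  0 <= c -> (forall i, `|u 0 i| <= c) -> `|u| <= c.
Proof.
move=> c0 uc; rewrite [leLHS]/Num.norm /= mx_normrE.
by apply/bigmax_leP; split=> // -[i j] _ /=; rewrite ord1.
Qed.

Lemma big_option (R : nmodType) (T : finType) (F : option T -> R) :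
  \sum_i F i = F None + \sum_j F (Some j).
Proof.
rewrite (bigD1 None) //=; congr (_ + _).
rewrite (reindex_omap Some id) /=; last by case.
by apply: eq_bigl => j; rewrite eqxx.
Qed.

Lemma lipschitz_continuous (R : realType) (V W : normedModType R) (f : V -> W) (L : R) :
  (forall x y, `|f x - f y| <= L * `|x - y|) -> continuous f.
Proof.
move=> fL x; apply/cvgrPdist_le => e e0.
have L0 : 0 < `|L| + 1 by rewrite ltr_wpDl.
near=> y; apply: (le_trans (fL x y)).
apply: (@le_trans _ _ ((`|L| + 1) * `|x - y|)).
  by rewrite ler_wpM2r // (le_trans (ler_norm L)) // lerDl.
rewrite mulrC -ler_pdivlMr //.
near: y; apply: cvgr_dist_le; first exact: cvg_id.
by rewrite divr_gt0.
Unshelve. all: by end_near. Qed.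

Section SimplexCoordinates.
Variables (R : realType) (d : nat) (M K : R).
Hypotheses (M0 : 0 < M) (MK : 2 * M * d.+1%:R <= K).

Let twoM_le : 2 * M <= K.
Proof. by apply: le_trans MK; rewrite ler_peMr ?ler1n // mulr_ge0 // ltW. Qed.

Let K0 : 0 <= K. Proof. by apply: le_trans twoM_le; rewrite mulr_ge0 // ltW. Qed.

(* Barycentric coordinates, up to a scaling, for a simplex containing the cube
   of radius M; the extra index None carries the slack. *)
Definition simplex_coord (i : option 'I_d) (x : 'rV[R]_d) : R :=
  if i is Some j then x 0 j + M else K - \sum_j (x 0 j + M).

Lemma sum_simplex_coord x : \sum_i simplex_coord i x = K.
Proof. by rewrite big_option /= subrK. Qed.

Lemma simplex_coord_ge0 i x : `|x| <= M -> 0 <= simplex_coord i x.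
Proof.
move=> xM; have xjM j : - M <= x 0 j <= M.
  by rewrite -ler_norml (le_trans (coord_le_norm x j)).
case: i => [j|] /=; first by have := xjM j; lra.
rewrite subr_ge0 (@le_trans _ _ (\sum_(j < d) 2 * M)) //.
  by apply: ler_sum => j _; have := xjM j; lra.
rewrite sumr_const card_ord -[leLHS]mulr_natr (le_trans _ MK) // ler_wpM2l ?ler_nat //.
by rewrite mulr_ge0 // ltW.
Qed.

Lemma simplex_coord_lipschitz i x y :
  simplex_coord i x <= simplex_coord i y + d.+1%:R * `|x - y|.
Proof.
have xy j : `|x 0 j - y 0 j| <= `|x - y|.
  by have := coord_le_norm (x - y) j; rewrite !mxE.
case: i => [j|] /=.
  have := xy j; rewrite ler_norml => /andP[_ H].
  have : `|x - y| <= d.+1%:R * `|x - y| by rewrite ler_peMl // ler1n.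
  lra.
have : \sum_(j < d) (y 0 j + M) - \sum_(j < d) (x 0 j + M) <= d.+1%:R * `|x - y|.
  rewrite -sumrB (@le_trans _ _ (\sum_(j < d) `|x - y|)) //.
    by apply: ler_sum => j _; have := xy j; rewrite ler_norml; lra.
  rewrite sumr_const card_ord -[leLHS]mulr_natl ler_wpM2r // ler_nat; lia.
lra.
Qed.

Definition grid_point N (a : grid (option 'I_d) N) : 'rV[R]_d :=
  \row_j (K * (val a (Some j))%:R / N%:R - M).

Lemma simplex_coord_grid N (a : grid (option 'I_d) N) i : (0 < N)%N ->
  simplex_coord i (grid_point a) = K * (val a i)%:R / N%:R.
Proof.
move=> N0; have H j : grid_point a 0 j + M = K * (val a (Some j))%:R / N%:R.
  by rewrite mxE subrK.
case: i => [j|] /=; first exact: H.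
under eq_bigr do rewrite H.
rewrite -mulr_suml -mulr_sumr.
have : (\sum_i (val a i)%:R : R) = N%:R by rewrite -natr_sum (eqP (valP a)).
rewrite big_option => HN; have N0' : (N%:R : R) != 0 by rewrite pnatr_eq0 -lt0n.
by rewrite (canRL (addKr _) HN); field.
Qed.

Lemma grid_point_close N (a b : grid (option 'I_d) N) : (0 < N)%N ->
  (forall i, (val a i <= val b i + d.+1)%N) ->
  (forall i, (val b i <= val a i + d.+1)%N) ->
  `|grid_point a - grid_point b| <= K * d.+1%:R / N%:R.
Proof.
move=> N0 ab ba.
apply: norm_le_coord => [|j]; first by apply/divr_ge0 => //; apply/mulr_ge0 => //.
rewrite !mxE opprB subrKA -mulrBl -mulrBr 2!normrM.
rewrite (ger0_norm K0) (@ger0_norm _ N%:R^-1) ?invr_ge0 //.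
rewrite ler_wpM2r ?invr_ge0 // ler_wpM2l //.
have := ab (Some j); have := ba (Some j); rewrite -!(ler_nat R) !natrD ler_norml; lra.
Qed.

Lemma grid_point_norm N (a : grid (option 'I_d) N) : (0 < N)%N -> `|grid_point a| <= K.
Proof.
move=> N0; apply: norm_le_coord => [|j] //.
rewrite mxE ler_norml.
have aN : 0 <= (val a (Some j))%:R / (N%:R : R) <= 1.
  by rewrite divr_ge0 // ler_pdivrMr ?ltr0n // mul1r ler_nat leq_ord.
rewrite -mulrA; set q := _ / _ in aN *; have : 0 <= K * q <= K; last by move: twoM_le M0; lra.
by case/andP: aN => q0 q1; rewrite mulr_ge0 ?ler_piMr.
Qed.

End SimplexCoordinates.

(** A grid point is coloured by a barycentric coordinate that [f] does not decrease. In a small cell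
    each coordinate of [x] is then either nearly not decreased, by comparison with a nearby point of
    that colour, or itself nearly 0, while that of [f x] is nonnegative. As the changes sum to 0,
    all of them are small. *)
Lemma approx_fixpoint (R : realType) d (f : 'rV[R]_d -> 'rV[R]_d) (L M e : R) :
  0 < M -> 0 <= L -> 0 < e ->
  (forall x, `|f x| <= M) -> (forall x y, `|f x - f y| <= L * `|x - y|) ->
  exists2 x, `|x| <= 2 * M * d.+1%:R & `|f x - x| <= e.
Proof.
move=> M0 L0 e0 fM fL; pose K := 2 * M * d.+1%:R; pose D : R := d.+1%:R.
have MK : 2 * M * d.+1%:R <= K by [].
pose u := @simplex_coord R d M K.
have K0 : 0 < K by rewrite !mulr_gt0.
have D0 : 0 < D by rewrite ltr0n.
(* The cell has diameter at most [K * D / N], a coordinate drops by at most [D * (1 + L)] times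
   that, and the last factor [D] accounts for summing over the coordinates. *)
pose C := D * (D * (1 + L)) * (K * D).
have C0 : 0 <= C by rewrite !mulr_ge0 // ?addr_ge0 // ltW.
pose N := (Num.truncn (C / e)).+1; have N0 : (0 < N)%N by [].
have CN : C / N%:R <= e.
  rewrite ler_pdivrMr ?ltr0n // mulrC -ler_pdivrMr //.
  exact/ltW/truncnS_gt.
(* The default is never taken: the coordinates of both points sum to [K], so they cannot all
   decrease. *)
pose colour (a : grid (option 'I_d) N) :=
  odflt None [pick i | u i (grid_point M K a) <= u i (f (grid_point M K a))].
have colourP a : u (colour a) (grid_point M K a) <= u (colour a) (f (grid_point M K a)).
  rewrite /colour; case: pickP => //= H.
  have : \sum_i u i (f (grid_point M K a)) < \sum_i u i (grid_point M K a).
    apply: ltr_sum; last by move=> i _; rewrite ltNge H.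
    by apply/hasP; exists None; rewrite ?mem_index_enum.
  by rewrite !sum_simplex_coord ltxx.
have [S [/set0Pn[a aS] Sclose Scol]] := exists_small_cell colour None.
rewrite card_option card_ord in Sclose Scol.
pose x := grid_point M K a; pose eta := K * D / N%:R.
have eta0 : 0 <= eta by rewrite !mulr_ge0 ?invr_ge0 // ltW.
exists x; first exact: grid_point_norm.
have uf i : u i x - u i (f x) <= D * (1 + L) * eta.
  have [[b bS bi]|small] := Scol i.
    have xb : `|x - grid_point M K b| <= eta.
      by apply: grid_point_close => // j; apply: Sclose.
    have := colourP b; rewrite bi.
    have := simplex_coord_lipschitz M0 MK i x (grid_point M K b).
    have := simplex_coord_lipschitz M0 MK i (f (grid_point M K b)) (f x).
    rewrite -/(u _ _) -/(u _ _) -/(u _ _) -/(u _ _) -/D.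
    have fxb : `|f (grid_point M K b) - f x| <= L * eta.
      by rewrite (le_trans (fL _ _)) // distrC ler_wpM2l.
    have := ler_wpM2l (ltW D0) fxb; have := ler_wpM2l (ltW D0) xb.
    rewrite mulrDr mulr1 mulrDl -mulrA; lra.
  have := simplex_coord_ge0 M0 MK i (fM x); rewrite -/(u _ _) => ufx0.
  have uxe : u i x <= eta.
    rewrite /u simplex_coord_grid // ler_wpM2r ?invr_ge0 // ler_wpM2l ?(ltW K0) //.
    by rewrite ler_nat small.
  have : eta <= D * (1 + L) * eta; last lra.
  rewrite ler_peMl //; have : 1 <= D by rewrite ler1n.
  by move=> D1; rewrite -[1]mulr1 ler_pM //; lra.
have DLe : D * (D * (1 + L) * eta) <= e.
  by apply: le_trans CN; rewrite /C /eta; rewrite le_eqVlt; apply/orP; left; apply/eqP; ring.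
have c0 : 0 <= D * (1 + L) * eta by rewrite !mulr_ge0 // ?addr_ge0 // ltW.
apply: norm_le_coord => [|j]; first exact: ltW.
have -> : (f x - x) 0 j = f x 0 j - x 0 j by rewrite !mxE.
rewrite ler_norml; apply/andP; split.
  have := uf (Some j); rewrite /u /=.
  have : D * (1 + L) * eta <= D * (D * (1 + L) * eta) by rewrite ler_peMl // ler1n.
  lra.
(* The increase of one coordinate equals the total decrease of the others, already bounded by
   [uf]. *)
have : \sum_i (u i x - u i (f x)) = 0 by rewrite sumrB !sum_simplex_coord subrr.
rewrite (bigD1 (Some j)) //= => sum0.
have : \sum_(i | i != Some j) (u i x - u i (f x)) <= D * (D * (1 + L) * eta).
  rewrite (@le_trans _ _ (\sum_(i | i != Some j) D * (1 + L) * eta)) //.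
    exact: ler_sum.
  rewrite sumr_const -[leLHS]mulr_natl ler_wpM2r // ler_nat cardC1 card_option card_ord.
  exact: leqnSn.
move: sum0; rewrite /u /=.
set rest := \sum_(i | _) _; lra.
Qed.

(** The displacement [|f x - x|] attains its minimum on the ball containing all approximate fixed
    points; a positive minimum would be undercut by one of half that displacement. *)
Lemma lipschitz_fixpoint (R : realType) d (f : 'rV[R]_d -> 'rV[R]_d) (L M : R) :
  0 < M -> 0 <= L ->
  (forall x, `|f x| <= M) -> (forall x y, `|f x - f y| <= L * `|x - y|) ->
  exists x, f x = x.
Proof.
move=> M0 L0 fM fL; pose K := 2 * M * d.+1%:R.
pose B : set 'rV[R]_d := [set x | `|x| <= K].
have K0 : 0 <= K by rewrite !mulr_ge0 // ltW.
have cB : compact B.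
  apply: bounded_closed_compact.
    by exists K; split; [exact: num_real|move=> c Kc x /= /le_trans; apply; exact: ltW].
  rewrite (_ : B = Num.norm @^-1` [set r : R | r <= K]) //.
  by apply: (preimage_closed _ (@closed_le _ K)) => x _; exact: norm_continuous.
have [||x xB xmin] := @EVT_min_rV R d (fun x => `|f x - x|) B _ cB.
- by exists 0; rewrite /B /= normr0.
- apply: continuous_subspaceT; apply: (@lipschitz_continuous _ _ _ _ (L + 1)) => x y.
  rewrite (le_trans (ler_dist_dist _ _)) // opprB (addrC y) addrACA.
  rewrite (le_trans (ler_normD _ _)) // mulrDl mul1r lerD //.
  by rewrite addrC distrC.
exists x; apply/eqP; rewrite -subr_eq0 -normr_le0 leNgt; apply/negP => fx0.
have [|y yB fy] := approx_fixpoint (e := `|f x - x| / 2) M0 L0 _ fM fL; first lra.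
have : `|f x - x| <= `|f y - y| by apply: xmin; rewrite inE.
lra.
Qed.

(** * Euclidean structure and convexity *)

Section EuclideanStructure.
Variables (R : realType) (d : nat).
Implicit Types u v w : 'rV[R]_d.

Lemma dotvC u v : dotv u v = dotv v u.
Proof. by apply: eq_bigr => i _; rewrite mulrC. Qed.

Lemma dotvDl u v w : dotv (u + v) w = dotv u w + dotv v w.
Proof. by rewrite -big_split; apply: eq_bigr => i _; rewrite mxE mulrDl. Qed.

Lemma dotvZl a u v : dotv (a *: u) v = a * dotv u v.
Proof. by rewrite mulr_sumr; apply: eq_bigr => i _; rewrite mxE mulrA. Qed.

Lemma dotvNl u v : dotv (- u) v = - dotv u v.
Proof. by rewrite -scaleN1r dotvZl mulN1r. Qed.

Lemma dotvDr u v w : dotv u (v + w) = dotv u v + dotv u w.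
Proof. by rewrite dotvC dotvDl !(dotvC u). Qed.

Lemma dotvZr a u v : dotv u (a *: v) = a * dotv u v.
Proof. by rewrite dotvC dotvZl dotvC. Qed.

Lemma dotvNr u v : dotv u (- v) = - dotv u v.
Proof. by rewrite dotvC dotvNl dotvC. Qed.

Definition dotvE := (dotvDl, dotvDr, dotvNl, dotvNr, dotvZl, dotvZr).

Lemma dotv0r u : dotv u 0 = 0.
Proof. by rewrite -(scale0r 0) dotvZr mul0r. Qed.

Lemma dotvv_ge0 u : 0 <= dotv u u.
Proof. by apply: sumr_ge0 => i _; rewrite -expr2 sqr_ge0. Qed.

Lemma sqr_enorm u : enorm u ^+ 2 = dotv u u.
Proof. by rewrite sqr_sqrtr // dotvv_ge0. Qed.

Lemma enorm_ge0 u : 0 <= enorm u.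
Proof. exact: sqrtr_ge0. Qed.

Lemma enormN u : enorm (- u) = enorm u.
Proof. by rewrite /enorm !dotvE opprK. Qed.

Lemma enormZ a u : enorm (a *: u) = `|a| * enorm u.
Proof. by rewrite /enorm !dotvE mulrA -expr2 sqrtrM ?sqr_ge0 // sqrtr_sqr. Qed.

Lemma norm_le_enorm u : `|u| <= enorm u.
Proof.
apply: norm_le_coord => [|i]; first exact: enorm_ge0.
rewrite -sqrtr_sqr ler_sqrt ?dotvv_ge0 // /dotv (bigD1 i) //= -expr2 lerDl.
by apply: sumr_ge0 => j _; rewrite -expr2 sqr_ge0.
Qed.

Lemma dotv_norm_le u v : `|dotv u v| <= d%:R * (`|u| * `|v|).
Proof.
apply: (le_trans (ler_norm_sum _ _ _)).
rewrite (@le_trans _ _ (\sum_(i < d) `|u| * `|v|)) //.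
  by apply: ler_sum => i _; rewrite normrM ler_pM // coord_le_norm.
by rewrite sumr_const card_ord -[leLHS]mulr_natl.
Qed.

Lemma enorm_le_norm u : enorm u <= d%:R * `|u|.
Proof.
rewrite -(@ler_pXn2r _ 2) ?nnegrE ?mulr_ge0 ?enorm_ge0 // sqr_enorm exprMn.
rewrite (le_trans (ler_norm _)) // (le_trans (dotv_norm_le _ _)) // -expr2.
by rewrite ler_wpM2r ?sqr_ge0 // -natrX ler_nat; nia.
Qed.

Lemma cauchy_schwarz u v : dotv u v <= enorm u * enorm v.
Proof.
have [u0|u0] := eqVneq (enorm u) 0.
  have : `|u| <= 0 by rewrite -u0 norm_le_enorm.
  by rewrite normr_le0 => /eqP ->; rewrite dotvC dotv0r mulr_ge0 ?enorm_ge0.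
have [v0|v0] := eqVneq (enorm v) 0.
  have : `|v| <= 0 by rewrite -v0 norm_le_enorm.
  by rewrite normr_le0 => /eqP ->; rewrite dotv0r mulr_ge0 ?enorm_ge0.
have uv : 0 < enorm u * enorm v.
  by rewrite mulr_gt0 // lt_neqAle eq_sym ?u0 ?v0 enorm_ge0.
(* This combination vanishes when [u] and [v] are positively proportional, the case of equality. *)
have := dotvv_ge0 (enorm v *: u - enorm u *: v).
rewrite (_ : dotv _ _ = 2 * (enorm u * enorm v) * (enorm u * enorm v - dotv u v)).
  by rewrite pmulr_rge0 ?subr_ge0 // mulr_gt0.
by rewrite !dotvE -!sqr_enorm (dotvC v u); ring.
Qed.

Lemma dotv_cvg (T : Type) (G : set_system T) {FG : Filter G} (u v : T -> 'rV[R]_d)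
    (a b : 'rV[R]_d) :
  u @ G --> a -> v @ G --> b -> dotv (u x) (v x) @[x --> G] --> dotv a b.
Proof.
move=> ua vb; apply: cvg_big => [|i _]; first exact: add_continuous.
have coord (w : T -> 'rV[R]_d) (c : 'rV[R]_d) : w @ G --> c -> w x 0 i @[x --> G] --> c 0 i.
  move=> wc; apply: (@continuous_cvg _ _ _ G _ w (fun z : 'rV[R]_d => z 0 i) c _ wc).
  exact: coord_continuous.
by apply: cvgM; exact: coord.
Qed.

End EuclideanStructure.

(** Dividing by [s] and letting it tend to 0; this is how first-order conditions along a segment are
    extracted below. *)
Lemma ge0_of_quadratic (R : realFieldType) (a b : R) :
  (forall s, 0 < s <= 1 -> 0 <= s * a + s ^+ 2 * b) -> 0 <= a.
Proof.
move=> H; rewrite leNgt; apply/negP => a0.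
have D0 : 0 < `|b| + 1 - a by have := normr_ge0 b; lra.
(* With this [s] one has [s * (|b| + 1 - a) = - a], so [s * |b|] is strictly less than [- a]. *)
have s01 : 0 < - a / (`|b| + 1 - a) <= 1.
  by rewrite divr_gt0 ?oppr_gt0 //= ler_pdivrMr // mul1r; have := normr_ge0 b; lra.
have := H _ s01; set s := _ / _ in s01 *.
have /andP[s0 _] := s01; rewrite expr2 -mulrA -mulrDr pmulr_rge0 //.
have : s * b <= s * `|b| by rewrite ler_pM2l // ler_norm.
have : s * (`|b| + 1 - a) = - a by rewrite /s divfK // gt_eqF.
nra.
Qed.

Lemma linear_bounded (R : realType) d (J : {linear 'rV[R]_d -> 'rV[R]_d}) :
  exists2 c : R, 0 <= c & forall h, `|J h| <= c * `|h|.
Proof.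
pose B := lin1_mx J; exists (\sum_j \sum_k `|B k j|).
  by apply: sumr_ge0 => j _; apply: sumr_ge0.
move=> h; apply: norm_le_coord => [|j].
  by rewrite mulr_ge0 // sumr_ge0 // => j _; apply: sumr_ge0.
rewrite -mul_rV_lin1 mxE (le_trans (ler_norm_sum _ _ _)) //.
apply: (@le_trans _ _ ((\sum_k `|B k j|) * `|h|)); last first.
  rewrite ler_wpM2r // [leRHS](bigD1 j) //= lerDl.
  by apply: sumr_ge0 => i _; apply: sumr_ge0.
rewrite mulr_suml; apply: ler_sum => k _; rewrite normrM mulrC ler_wpM2l //.
exact: coord_le_norm.
Qed.

Definition convex_set (R : realType) d (X : set 'rV[R]_d) : Prop :=
  forall x y (s : R), X x -> X y -> 0 <= s <= 1 -> X (x + s *: (y - x)).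

Lemma polyhedron_convex (R : realType) d (X : set 'rV[R]_d) : polyhedron X -> convex_set X.
Proof.
move=> [m [A [b ->]]] x y s /= Xx Xy /andP[s0 s1] i.
rewrite mulmxDl -scalemxAl mulmxBl !mxE.
have := Xx i; have := Xy i; rewrite !mxE; nra.
Qed.

Lemma polyhedron_closed (R : realType) d (X : set 'rV[R]_d) : polyhedron X -> closed X.
Proof.
move=> [m [A [b ->]]].
rewrite (_ : [set _ | _] = \bigcap_(i in [set: 'I_m]) [set x | dotv x (col i A)^T <= b 0 i]).
  apply: closed_bigI => i _.
  apply: (preimage_closed _ (@closed_le _ (b 0 i))) => x _.
  apply: (@dotv_cvg _ _ _ (nbhs x) _ id (fun=> (col i A)^T)); first exact: cvg_id.
  exact: cvg_cst.
have E x i : dotv x (col i A)^T = (x *m A) 0 i.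
  by rewrite mxE; apply: eq_bigr => k _; rewrite !mxE.
by apply/seteqP; split=> x /= H i => [_|]; [rewrite /= E|rewrite -E; apply: H].
Qed.

(** * The gap function *)

(** Shared by two problems: with [p = F x] it is the negated expression maximized in the gap
    function, and with [p] a gradient and [lambda] the stepsize it is the objective of a proximal
    gradient step on [X]. *)
Definition prox_obj (R : realType) d (lambda : R) (p x y : 'rV[R]_d) : R :=
  dotv p (y - x) + (2 * lambda)^-1 * enorm (y - x) ^+ 2.

(** First-order optimality along the segment from [y] to [w], scaled by [lambda]: it says that [y]
    is the projection of [x - lambda *: p] onto [X]. *)
Lemma prox_obj_VI (R : realType) d (X : set 'rV[R]_d) (lambda : R) p x y :
  convex_set X -> 0 < lambda -> X y ->
  (forall w, X w -> prox_obj lambda p x y <= prox_obj lambda p x w) ->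
  forall w, X w -> 0 <= dotv (lambda *: p + (y - x)) (w - y).
Proof.
move=> cX l0 Xy ymin w Xw.
apply: (@ge0_of_quadratic _ _ (dotv (w - y) (w - y) / 2)) => s /andP[s0 s1].
have s01 : 0 <= s <= 1 by rewrite ltW.
have := ymin _ (cX _ _ _ Xy Xw s01); rewrite /prox_obj -subr_ge0.
rewrite (addrAC y); move: (w - y) (y - x) => v u.
rewrite -(pmulr_rge0 _ l0) !sqr_enorm => H.
apply: le_trans H _; rewrite le_eqVlt; apply/orP; left; apply/eqP.
rewrite !dotvE (dotvC v u); field; exact: lt0r_neq0.
Qed.

Lemma shift_continuous (R : realType) d (x : 'rV[R]_d) :
  continuous (fun z : 'rV[R]_d => z - x).
Proof.
apply: (@lipschitz_continuous R 'rV[R]_d 'rV[R]_d (fun z => z - x) 1) => z z'.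
by rewrite mul1r opprB addrA subrK.
Qed.

Lemma exists_prox (R : realType) d (X : set 'rV[R]_d) (lambda : R) p x :
  compact X -> X !=set0 ->
  exists y, X y /\ forall w, X w -> prox_obj lambda p x y <= prox_obj lambda p x w.
Proof.
move=> cX X0; have [|y] := EVT_min_rV (f := prox_obj lambda p x) X0 cX.
  apply: continuous_subspaceT => y; rewrite /prox_obj.
  under eq_fun do rewrite sqr_enorm.
  have yx : z - x @[z --> y] --> y - x by exact: shift_continuous.
  have px : dotv p (z - x) @[z --> y] --> dotv p (y - x) by exact: (dotv_cvg (cvg_cst p) yx).
  have xx : dotv (z - x) (z - x) @[z --> y] --> dotv (y - x) (y - x).
    exact: (dotv_cvg yx yx).
  exact: (cvgD px (cvgM (cvg_cst (2 * lambda)^-1) xx)).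
rewrite inE => Xy ymin; exists y; split=> // w Xw.
by apply: ymin; rewrite inE.
Qed.

Section GapFunction.
Variables (R : realType) (d : nat) (X : set 'rV[R]_d) (lambda : R).
Hypotheses (cX : compact X) (X0 : X !=set0) (l0 : 0 < lambda).
Implicit Types F : 'rV[R]_d -> 'rV[R]_d.

Lemma gap_prox F x y : X y ->
  (forall w, X w -> prox_obj lambda (F x) x y <= prox_obj lambda (F x) x w) ->
  gap lambda F X x = - prox_obj lambda (F x) x y.
Proof.
move=> Xy ymin.
have E w : dotv (F x) (x - w) - (2 * lambda)^-1 * enorm (x - w) ^+ 2 =
    - prox_obj lambda (F x) x w.
  by rewrite /prox_obj -(opprB x w) enormN dotvNr opprD opprK.
rewrite /gap; under [X in sup X]eq_imagel do rewrite E.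
have ub : ubound [set - prox_obj lambda (F x) x w | w in X] (- prox_obj lambda (F x) x y).
  by move=> _ [w Xw <-]; rewrite lerN2 ymin.
apply/eqP; rewrite eq_le; apply/andP; split.
  by apply: ge_sup => //; exists (- prox_obj lambda (F x) x y); exists y.
by apply: ub_le_sup; [exists (- prox_obj lambda (F x) x y)|exists y].
Qed.

Lemma le_gap F x w : X w -> - prox_obj lambda (F x) x w <= gap lambda F X x.
Proof.
move=> Xw; have [y [Xy ymin]] := @exists_prox R d X lambda (F x) x cX X0.
by rewrite (gap_prox Xy ymin) lerN2 ymin.
Qed.

Lemma gap_ge0 F x : X x -> 0 <= gap lambda F X x.
Proof.
move=> /(le_gap F x); apply: le_trans.
by rewrite /prox_obj subrr sqr_enorm !dotv0r mulr0 addr0 oppr0.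
Qed.

Lemma gap_perturb F F' x c :
  (forall w, X w -> dotv (F' x - F x) (x - w) <= c) ->
  gap lambda F' X x <= gap lambda F X x + c.
Proof.
move=> Fc; have [y [Xy ymin]] := @exists_prox R d X lambda (F' x) x cX X0.
rewrite (gap_prox Xy ymin); have := le_gap F x Xy; have := Fc y Xy.
rewrite /prox_obj -(opprB y x) dotvNr dotvDl dotvNl; lra.
Qed.

Lemma gap_eq0_VI F x : convex_set X -> X x -> gap lambda F X x = 0 -> VI_solution F X x.
Proof.
move=> convX Xx gx0; split=> // w Xw.
apply: (@ge0_of_quadratic _ _ ((2 * lambda)^-1 * dotv (w - x) (w - x))).
move=> s /andP[s0 s1]; have s01 : 0 <= s <= 1 by rewrite ltW.
have := le_gap F x (convX _ _ _ Xx Xw s01); rewrite gx0 oppr_le0 /prox_obj.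
rewrite (addrC x) addrK sqr_enorm !dotvE; set a := dotv _ _; nra.
Qed.

Lemma VI_gap_eq0 F x : VI_solution F X x -> gap lambda F X x = 0.
Proof.
case=> Xx Fx; apply: le_anti; rewrite gap_ge0 // andbT.
have [y [Xy ymin]] := @exists_prox R d X lambda (F x) x cX X0.
rewrite (gap_prox Xy ymin) oppr_le0 addr_ge0 ?Fx // mulr_ge0 ?sqr_ge0 //.
by rewrite invr_ge0 mulr_ge0 // ltW.
Qed.

Section AffineMap.
Variables (F : 'rV[R]_d -> 'rV[R]_d) (J : {linear 'rV[R]_d -> 'rV[R]_d}).
Hypothesis FD : forall x h, F (x + h) = F x + J h.
Hypothesis convX : convex_set X.
Variable y : 'rV[R]_d -> 'rV[R]_d.
Hypothesis yX : forall x, X (y x).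
Hypothesis ymin : forall x w, X w ->
  prox_obj lambda (F x) x (y x) <= prox_obj lambda (F x) x w.

(** Testing the projection inequality of each point at the other and adding them gives
    nonexpansiveness in the Euclidean norm; the factor [d] pays for the passage to the max norm. *)
Lemma prox_lipschitz : exists2 c : R, 0 <= c &
  forall x x', `|y x - y x'| <= c * `|x - x'|.
Proof.
have [c c0 Jc] := linear_bounded J.
have c'0 : 0 <= d%:R * (1 + lambda * c).
  by rewrite mulr_ge0 // addr_ge0 // mulr_ge0 // ltW.
exists (d%:R * (1 + lambda * c)) => // x x'.
have V1 := prox_obj_VI convX l0 (yX x) (ymin x) (yX x').
have V2 := prox_obj_VI convX l0 (yX x') (ymin x') (yX x).
have Fxx' : F x = F x' + J (x - x') by rewrite -FD addrC subrK.
set u := y x - y x'.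
have uu : dotv u u <= dotv ((x - x') - lambda *: J (x - x')) u.
  move: V1 V2; rewrite Fxx' /u; move: (J _) => j; rewrite !dotvE; lra.
have un : `|(x - x') - lambda *: J (x - x')| <= (1 + lambda * c) * `|x - x'|.
  rewrite (le_trans (ler_normB _ _)) // mulrDl mul1r lerD //.
  by rewrite normrZ gtr0_norm // -mulrA ler_wpM2l ?Jc // ltW.
have := ler_wpM2r (normr_ge0 u) un; move: (_ - lambda *: _) un uu => v un uu H.
have [->|u0] := eqVneq u 0; first by rewrite normr0 mulr_ge0.
have {}u0 : 0 < `|u| by rewrite normr_gt0.
rewrite -(ler_pM2r u0) -expr2 -!mulrA.
have : `|u| ^+ 2 <= dotv u u.
  by rewrite -sqr_enorm ler_pXn2r ?nnegrE ?enorm_ge0 ?norm_le_enorm.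
move/le_trans; apply; apply: (le_trans uu); apply: (le_trans (ler_norm _)).
by rewrite (le_trans (dotv_norm_le _ _)) // ler_wpM2l // mulrA.
Qed.

(** At a fixed point of the maximizer map [y] the maximum is the value at [x] itself, namely 0. The
    fixed point theorem applies because [y] takes values in the bounded set [X]. *)
Lemma exists_gap_eq0 : exists2 x, X x & gap lambda F X x = 0.
Proof.
have [c c0 yc] := prox_lipschitz.
have [M [_ XM]] := compact_bounded cX.
have M1 : 0 < `|M| + 1 by rewrite ltr_wpDl.
have yM x : `|y x| <= `|M| + 1.
  by apply: XM; [rewrite (le_lt_trans (ler_norm M)) // ltrDl|exact: yX].
have [x yx] := lipschitz_fixpoint M1 c0 yM yc.
exists x; first by rewrite -yx.
rewrite (gap_prox (yX x) (ymin x)) yx.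
by rewrite /prox_obj subrr sqr_enorm !dotv0r mulr0 addr0 oppr0.
Qed.

(** Danskin's formula: the derivative in [x] of the maximized expression, with the maximizer [y x]
    held fixed. *)
Definition gap_differential x h : R :=
  dotv (F x) h + dotv (J h) (x - y x) - lambda^-1 * dotv (x - y x) h.

(** Inserting the old maximizer at [x + h] bounds the gap from below, and inserting the new one at
    [x] bounds it from above. The expression is exactly quadratic in [h], with second-order part
    [rem h], and the two bounds differ by terms bilinear in [h] and the displacement of the
    maximizer, which is Lipschitz in [h]. *)
Lemma gap_expansion : exists2 K : R, 0 <= K & forall x h,
  `|gap lambda F X (x + h) - gap lambda F X x - gap_differential x h| <= K * `|h| ^+ 2.
Proof.
have [c c0 Jc] := linear_bounded J; have [k k0 yk] := prox_lipschitz.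
have li0 : 0 <= lambda^-1 by rewrite invr_ge0 ltW.
have l2i0 : 0 <= (2 * lambda)^-1 by rewrite invr_ge0 mulr_ge0 // ltW.
pose rem h := dotv (J h) h - (2 * lambda)^-1 * dotv h h.
pose K1 := d%:R * c + (2 * lambda)^-1 * d%:R.
pose K2 := d%:R * c * k + lambda^-1 * (d%:R * k).
have K10 : 0 <= K1 by rewrite addr_ge0 // mulr_ge0.
have K20 : 0 <= K2 by rewrite addr_ge0 // !mulr_ge0.
have dh (u v : 'rV[R]_d) (a b : R) : `|u| <= a -> `|v| <= b -> `|dotv u v| <= d%:R * (a * b).
  move=> ua vb; apply: le_trans (dotv_norm_le u v) _.
  by apply: ler_wpM2l => //; apply: ler_pM.
exists (K1 + K2) => [|x h]; first exact: addr_ge0.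
have remh : `|rem h| <= K1 * `|h| ^+ 2.
  rewrite (le_trans (ler_normB _ _)) // [leRHS]mulrDl lerD //.
    by have := dh _ _ _ _ (Jc h) (lexx `|h|); rewrite -!mulrA -expr2.
  by rewrite normrM (ger0_norm l2i0) -[leRHS]mulrA ler_wpM2l // expr2 dotv_norm_le.
have E w : - prox_obj lambda (F (x + h)) (x + h) w = - prox_obj lambda (F x) x w +
    (dotv (F x) h + dotv (J h) (x - w) - lambda^-1 * dotv (x - w) h) + rem h.
  rewrite FD /prox_obj /rem !sqr_enorm !dotvE.
  rewrite (dotvC h w) (dotvC h x) (dotvC x w); field; exact: lt0r_neq0.
have lower : gap lambda F X x + gap_differential x h + rem h <= gap lambda F X (x + h).
  have := le_gap F (x + h) (yX x); rewrite E (gap_prox (yX x) (ymin x)).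
  by rewrite /gap_differential.
have upper : gap lambda F X (x + h) <= gap lambda F X x +
    (dotv (F x) h + dotv (J h) (x - y (x + h)) - lambda^-1 * dotv (x - y (x + h)) h) + rem h.
  rewrite (gap_prox (yX _) (ymin _)) E lerD2r lerD2r; exact: le_gap.
have yh : `|y x - y (x + h)| <= k * `|h|.
  by have := yk x (x + h); rewrite opprD addrA subrr sub0r normrN.
have diff : `|dotv (J h) (y x - y (x + h)) - lambda^-1 * dotv (y x - y (x + h)) h|
    <= K2 * `|h| ^+ 2.
  rewrite (le_trans (ler_normB _ _)) // [leRHS]mulrDl lerD //.
    have := dh _ _ _ _ (Jc h) yh.
    by rewrite (_ : d%:R * _ = d%:R * c * k * `|h| ^+ 2) //; ring.
  rewrite normrM (ger0_norm li0) -[leRHS]mulrA ler_wpM2l //.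
  have := dh _ _ _ _ yh (lexx `|h|).
  by rewrite (_ : d%:R * _ = d%:R * k * `|h| ^+ 2) //; ring.
rewrite [leRHS]mulrDl; move: remh diff lower upper; rewrite /gap_differential.
rewrite !ler_norml !dotvE; move: (`|h| ^+ 2) => hh.
rewrite /rem; lra.
Qed.

End AffineMap.
End GapFunction.

(** * The proximal gradient method *)

Lemma is_derive_of_expansion (R : realType) (V : normedModType R) (f : V -> R)
    (x v : V) (c K : R) :
  (forall r : R, `|f (x + r *: v) - f x - r * c| <= K * r ^+ 2) -> is_derive x v f c.
Proof.
move=> fK.
have H : (fun h : R => h^-1 *: ((f \o shift x) (h *: v) - f x)) @ 0^' --> c.
  apply/cvgrPdist_le => e e0; have D0 : 0 < `|K| + 1 by rewrite ltr_wpDl.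
  near=> h.
  have h0 : h != 0 by near: h; exact: nbhs_dnbhs_neq.
  have he : `|h| <= e / (`|K| + 1) by near: h; apply: dnbhs0_le; rewrite divr_gt0.
  have -> : c - h^-1 *: ((f \o shift x) (h *: v) - f x) =
      - (h^-1 * (f (x + h *: v) - f x - h * c)).
    by rewrite /shift /= [h *: v + x]addrC /GRing.scale /=; field.
  rewrite normrN normrM normfV ler_pdivrMl ?normr_gt0 //.
  rewrite (le_trans (fK h)) // -real_normK ?num_real // expr2.
  apply: (@le_trans _ _ ((`|K| + 1) * (`|h| * `|h|))).
    by rewrite ler_wpM2r ?mulr_ge0 // (le_trans (ler_norm _)) // lerDl.
  by rewrite mulrCA ler_wpM2l // mulrC -ler_pdivlMr.
apply: DeriveDef; first by apply/cvg_ex; exists c.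
exact: (cvg_lim _ H).
Unshelve. all: by end_near. Qed.

(** The expansion along basis vectors identifies the partial derivatives with the values of [l]
    there; linearity gives the rest. *)
Lemma gradient_of_expansion (R : realType) d (f l : 'rV[R]_d -> R) x (K : R) :
  (forall a u v, l (a *: u + v) = a * l u + l v) ->
  (forall h, `|f (x + h) - f x - l h| <= K * `|h| ^+ 2) ->
  forall h, dotv (gradient f x) h = l h.
Proof.
move=> lin fK h.
have l0 : l 0 = 0 by have := lin 1 0 0; rewrite scaler0 addr0 mul1r; lra.
have lZ a u : l (a *: u) = a * l u by rewrite -[a *: u]addr0 lin l0 addr0.
have lD u v : l (u + v) = l u + l v by rewrite -{1}[u]scale1r lin mul1r.
have part i : gradient f x 0 i = l (delta_mx 0 i).
  rewrite mxE; apply: derive_val.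
  apply: (@is_derive_of_expansion _ _ _ _ _ _ (K * `|delta_mx 0 i : 'rV[R]_d| ^+ 2)) => r.
  rewrite -lZ (le_trans (fK _)) // normrZ exprMn real_normK ?num_real //.
  by rewrite (mulrC (r ^+ 2)) mulrA.
rewrite [in RHS](row_sum_delta h) (big_morph l lD l0).
by apply: eq_bigr => i _; rewrite part lZ mulrC.
Qed.

Definition quadratic_expansion (R : realType) d (g : 'rV[R]_d -> R) (K : R) : Prop :=
  forall x h, `|g (x + h) - g x - dotv (gradient g x) h| <= K * `|h| ^+ 2.

Section ProximalGradient.
Variables (R : realType) (d : nat) (X : set 'rV[R]_d).
Variables (g : 'rV[R]_d -> R) (K L alpha : R).
Hypotheses (convX : convex_set X) (closedX : closed X).
Hypothesis gK : quadratic_expansion g K.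
Hypotheses (L0 : 0 < L) (gL : lipschitz_const L (gradient g)).
Hypothesis alphaL : 0 < alpha < L^-1.

Let a0 : 0 < alpha. Proof. by case/andP: alphaL. Qed.

Lemma prox_grad_stepP z z' : X z -> prox_grad_step alpha g X z z' ->
  X z' /\ forall w, X w ->
    prox_obj alpha (gradient g z) z z' <= prox_obj alpha (gradient g z) z w.
Proof.
move=> Xz zz'.
have E w : X w -> ((dotv (gradient g z) (w - z))%:E + indicator X w +
    ((2 * alpha)^-1 * enorm (w - z) ^+ 2)%:E)%E = (prox_obj alpha (gradient g z) z w)%:E.
  by move=> Xw; rewrite /indicator mem_set // adde0 -EFinD.
have Xz' : X z'.
  by apply: contrapT => Xz'; have := zz' z; rewrite (E z Xz) /indicator memNset.
by split=> // w Xw; have := zz' w; rewrite !E // lee_fin.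
Qed.

Lemma mean_value_segment z v :
  exists2 s, 0 < s < 1 & g (z + v) - g z = dotv (gradient g (z + s *: v)) v.
Proof.
pose f (s : R) := g (z + s *: v).
have df (s : R) : is_derive s 1 f (dotv (gradient g (z + s *: v)) v).
  apply: (@is_derive_of_expansion _ _ _ _ _ _ (K * `|v| ^+ 2)) => r.
  rewrite /f scalerDl addrA -dotvZr [r *: 1]mulr1.
  have := gK (z + s *: v) (r *: v).
  by rewrite normrZ exprMn real_normK ?num_real // (mulrC (r ^+ 2)) mulrA.
have [|s] := @MVT R f (fun s => dotv (gradient g (z + s *: v)) v) 0 1 ltr01.
  by apply: derivable_within_continuous => s _; have [] := df s.
rewrite in_itv /= /f scale1r scale0r addr0 subr0 mulr1 => s01 E.
by exists s.
Qed.

(** With [v = z' - z], the mean value theorem and the Lipschitz gradient bound the change of [g] by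
    the linear term at [z] plus [L] times the squared length of [v]. The step inequality tested at
    [z] makes [alpha] times the linear term at most minus that squared length, and
    [alpha * L < 1]. *)
Lemma prox_grad_descent z z' : X z -> prox_grad_step alpha g X z z' -> g z' <= g z.
Proof.
move=> Xz zz'; have [Xz' zmin] := prox_grad_stepP Xz zz'.
have := prox_obj_VI convX a0 Xz' zmin Xz.
have [s /andP[s0 s1]] := mean_value_segment z (z' - z).
rewrite addrCA subrr addr0 -(opprB z' z); move: (z' - z) => v gv.
rewrite dotvNr oppr_ge0 dotvDl dotvZl -sqr_enorm => H.
have := cauchy_schwarz (gradient g (z + s *: v) - gradient g z) v.
have := gL (z + s *: v) z.
rewrite addrAC subrr add0r enormZ gtr0_norm // dotvDl dotvNl -gv.
have := enorm_ge0 v; move: (enorm v) (enorm (_ - _)) (dotv _ _) H => n m p H n0 Hm Hp.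
have [_ aL] := andP alphaL.
have aL1 : alpha * L < 1 by rewrite -ltr_pdivlMr // div1r.
have mn : m * n <= L * n ^+ 2.
  rewrite expr2 mulrA ler_wpM2r //; apply: le_trans Hm _.
  by rewrite ler_wpM2l ?(ltW L0) // ler_piMl // ltW.
rewrite -subr_le0 -(pmulr_rle0 _ a0).
have : alpha * (g z' - g z) <= alpha * (p + L * n ^+ 2).
  by rewrite ler_pM2l //; lra.
have : alpha * L * n ^+ 2 <= n ^+ 2 by rewrite ler_piMl ?sqr_ge0 // ltW.
lra.
Qed.

Lemma gradient_continuous : continuous (gradient g).
Proof.
apply: (@lipschitz_continuous R 'rV[R]_d 'rV[R]_d _ (L * d%:R)) => x y.
rewrite (le_trans (norm_le_enorm _)) // (le_trans (gL _ _)) // -mulrA.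
by rewrite ler_wpM2l ?(ltW L0) // enorm_le_norm.
Qed.

(** Increments of the convergent sequence tend to 0, so the projection inequalities of the steps
    pass to the limit as the first-order condition at [w]. *)
Lemma prox_grad_limit (z : nat -> 'rV[R]_d) w :
  X (z 0%N) -> (forall j, prox_grad_step alpha g X (z j) (z j.+1)) ->
  z @ \oo --> w -> [/\ X w, critical_points g X w & g w <= g (z 0%N)].
Proof.
move=> Xz0 zstep zw.
have Xz j : X (z j).
  by elim: j => // j IH; have [] := prox_grad_stepP IH (zstep j).
have Xw : X w by apply: (closed_cvg _ closedX _ _ zw); near=> n.
have zSw : z n.+1 @[n --> \oo] --> w by rewrite (cvg_shiftS z).
have shiftw (u : nat -> 'rV[R]_d) : u @ \oo --> w -> u n - w @[n --> \oo] --> w - w.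
  by move=> uw; exact: (continuous_cvg _ (@shift_continuous R d w w) uw).
split=> //.
  exists (- gradient g w); last by rewrite subrr.
  split=> // y Xy; rewrite dotvNl oppr_le0.
  have gw : gradient g (z n) @[n --> \oo] --> gradient g w.
    exact: (continuous_cvg _ (@gradient_continuous w) zw).
  have yz : y - z n.+1 @[n --> \oo] --> y - w.
    exact: (@cvgB R 'rV[R]_d _ _ _ (fun=> y) (fun n => z n.+1) _ _ (cvg_cst _) zSw).
  have zz : z n.+1 - z n @[n --> \oo] --> w - w.
    exact: (@cvgB R 'rV[R]_d _ _ _ (fun n => z n.+1) z _ _ zSw zw).
  have : alpha * dotv (gradient g (z n)) (y - z n.+1) + dotv (z n.+1 - z n) (y - z n.+1)
      @[n --> \oo] --> alpha * dotv (gradient g w) (y - w) + dotv (w - w) (y - w).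
    exact: (cvgD (cvgM (cvg_cst alpha) (dotv_cvg gw yz)) (dotv_cvg zz yz)).
  rewrite subrr [dotv 0 _]dotvC dotv0r addr0 => lim_VI.
  rewrite -(pmulr_rge0 _ a0); apply: (closed_cvg _ (@closed_ge _ 0) _ _ lim_VI).
  near=> n => /=; rewrite -dotvZl -dotvDl.
  have [Xz' zmin] := prox_grad_stepP (Xz n) (zstep n).
  exact: prox_obj_VI convX a0 Xz' zmin _ Xy.
have gz n : g (z n) <= g (z 0%N).
  by elim: n => // n; apply: le_trans; apply: prox_grad_descent.
have zw0 := shiftw _ zw.
(* By the expansion at [w], this quantity bounds [g w - g (z n)] from above. *)
have : dotv (- gradient g w) (z n - w) + `|K| * dotv (z n - w) (z n - w)
    @[n --> \oo] --> dotv (- gradient g w) (w - w) + `|K| * dotv (w - w) (w - w).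
  exact: (cvgD (dotv_cvg (cvg_cst (- gradient g w)) zw0)
               (cvgM (cvg_cst `|K|) (dotv_cvg zw0 zw0))).
rewrite subrr !dotv0r mulr0 addr0 => lim0.
rewrite -subr_le0; apply: (closed_cvg _ (@closed_ge _ (g w - g (z 0%N))) _ _ lim0).
near=> n => /=; have := gK w (z n - w); rewrite addrCA subrr addr0 ler_norml => /andP[+ _].
have : K * `|z n - w| ^+ 2 <= `|K| * dotv (z n - w) (z n - w).
  rewrite (@le_trans _ _ (`|K| * `|z n - w| ^+ 2)) //.
    by rewrite ler_wpM2r ?sqr_ge0 // ler_norm.
  rewrite ler_wpM2l // -sqr_enorm ler_pXn2r ?nnegrE ?enorm_ge0 //.
  exact: norm_le_enorm.
have := gz n; rewrite dotvNl; lra.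
Unshelve. all: by end_near. Qed.

End ProximalGradient.

(** * Homotopy continuation *)

Lemma exists_gap_zero_expansion (R : realType) d (X : set 'rV[R]_d) (lambda : R)
    (F : 'rV[R]_d -> 'rV[R]_d) :
  compact X -> X !=set0 -> convex_set X -> 0 < lambda -> affine_linear F ->
  (exists2 x, X x & gap lambda F X x = 0) /\
  exists K, quadratic_expansion (gap lambda F X) K.
Proof.
move=> cX X0 convX l0 [J [b FE]].
have FD x h : F (x + h) = F x + J h by rewrite !FE linearD addrAC.
have /choice[y yP] x := @exists_prox R d X lambda (F x) x cX X0.
have yX x := (yP x).1; have ymin x := (yP x).2.
split; first exact: (exists_gap_eq0 cX l0 FD convX yX ymin).
have [K K0 gK] := gap_expansion cX X0 l0 FD convX yX ymin.
exists K => x h; rewrite (gradient_of_expansion _ (gK x)) // => a u v.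
by rewrite /gap_differential linearP !dotvE; ring.
Qed.

Lemma affine_homotopy_map (R : realType) d (H : {linear 'rV[R]_d -> 'rV[R]_d})
    (F : 'rV[R]_d -> 'rV[R]_d) (s : R) :
  affine_linear F -> affine_linear (homotopy_map H F s).
Proof.
move=> [A [b FE]]; exists (s \*: H \+ (1 - s) \*: A), ((1 - s) *: b) => x.
by rewrite /homotopy_map FE scalerDr addrA.
Qed.

Lemma affine_linear_lipschitz (R : realType) d (F : 'rV[R]_d -> 'rV[R]_d) :
  affine_linear F ->
  exists2 c : R, 0 <= c & forall x y, `|F x - F y| <= c * `|x - y|.
Proof.
move=> [A [b FE]]; have [c c0 Ac] := linear_bounded A.
by exists c => // x y; rewrite !FE opprD addrACA subrr addr0 -linearB.
Qed.

(** A critical point that is not a minimizer has value above [sigma] plus the minimum, and the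
    minimum is nonnegative. So [w] is a minimizer, and the zero [x] forces its value to be 0. *)
Lemma critical_gap_le (R : realType) d (X : set 'rV[R]_d) (sigma : R)
    (g : 'rV[R]_d -> R) x w :
  critical_gap sigma g X -> (forall z, X z -> 0 <= g z) -> X x -> g x = 0 ->
  X w -> critical_points g X w -> g w <= sigma -> g w = 0.
Proof.
move=> gapg g0 Xx gx0 Xw critw gws.
have gobj z : X z -> gap_obj g X z = (g z)%:E.
  by move=> Xz; rewrite /gap_obj /indicator mem_set // adde0.
have [wmin|wmin] := pselect (global_minimizers g X w).
  have := wmin x; rewrite !gobj // lee_fin gx0 => gw0.
  by apply: le_anti; rewrite gw0 g0.
have min0 : (0 <= min_value g X)%E.
  apply: le_ereal_inf_tmp => _ [z _ <-].
  rewrite /gap_obj /indicator; case: ifP => [|_]; last by rewrite addey // leey.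
  by rewrite inE => Xz; rewrite adde0 lee_fin g0.
have infw : (ereal_inf (gap_obj g X @` (critical_points g X `\` global_minimizers g X))
    <= (g w)%:E)%E.
  by apply: ereal_inf_lbound; exists w => //; rewrite gobj.
move: gapg; rewrite /critical_gap => /lt_le_trans /(_ (leeB infw min0)).
by rewrite sube0 lte_fin ltNge gws.
Qed.

Lemma expr_eventually_lt (R : realType) (q e : R) : 0 <= q < 1 -> 0 < e ->
  exists n, forall m, (n <= m)%N -> q ^+ m < e.
Proof.
move=> /andP[q0 q1] e0.
have /cvgr0Pnorm_lt/(_ e e0)[n _ Hn] : GRing.exp q @ \oo --> 0.
  by apply: cvg_expr; rewrite ger0_norm.
exists n => m nm; have := Hn m nm.
by rewrite ger0_norm // exprn_ge0.
Qed.

Lemma homotopy_map_sub (R : realType) d (H F : 'rV[R]_d -> 'rV[R]_d) (s t : R) x :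
  homotopy_map H F s x - homotopy_map H F t x = (s - t) *: (H x - F x).
Proof. by apply/rowP => i; rewrite !mxE; ring. Qed.

Section HomotopyContinuation.
Variables (R : realType) (d : nat) (H : {linear 'rV[R]_d -> 'rV[R]_d}).
Variables (F : 'rV[R]_d -> 'rV[R]_d) (X : set 'rV[R]_d) (lambda delta sigma B : R).
Hypotheses (affF : affine_linear F) (cX : compact X) (X0 : X !=set0).
Hypotheses (convX : convex_set X) (l0 : 0 < lambda) (delta01 : 0 < delta < 1).
Hypotheses (sigma0 : 0 < sigma) (B0 : 0 < B).
Hypothesis gapX : forall s : R, 0 <= s <= 1 ->
  critical_gap sigma (gap lambda (homotopy_map H F s) X) X.
Hypothesis HFB : forall x w, X x -> X w -> `|dotv (H x - F x) (x - w)| <= B.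

Let g (s : R) := gap lambda (homotopy_map H F s) X.

Lemma trial_success (s t : R) x w :
  0 <= s <= 1 -> `|s - t| * B <= sigma -> X x -> g t x = 0 ->
  prox_grad_output (g s) X x w -> X w /\ g s w = 0.
Proof.
move=> s01 stB Xx gtx [L [alpha [z [[L0 gL] aL z0 zstep zw]]]].
have [[x' Xx' gx'] [K gK]] :=
  exists_gap_zero_expansion cX X0 convX l0 (affine_homotopy_map H s affF).
have closedX : closed X by apply: compact_closed.
have Xz0 : X (z 0%N) by rewrite z0.
have [Xw critw gw] := prox_grad_limit convX closedX gK L0 gL aL Xz0 zstep zw.
split=> //; apply: (critical_gap_le (gapX s01) _ Xx' gx' Xw critw).
  by move=> y; exact: gap_ge0.
apply: (le_trans gw); rewrite z0; apply: le_trans stB.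
rewrite -[leRHS]add0r -gtx; apply: gap_perturb => // y Xy.
rewrite homotopy_map_sub dotvZl (le_trans (ler_norm _)) // normrM.
by rewrite ler_wpM2l // HFB.
Qed.

(** Since [t] is at most 1, one trial index works for every outer iteration: the trial numbered
    [m.+1] cannot fail, so the accepted exponent is at most [m.+1]. *)
Lemma homotopy_step_contraction :
  exists2 q : R, 0 <= q < 1 & forall x t x' t', 0 <= t <= 1 -> X x -> g t x = 0 ->
    homotopy_step lambda delta H F X x t x' t' ->
    [/\ X x', g t' x' = 0 & 0 <= t' <= q * t].
Proof.
have /andP[d0 d1] := delta01.
have [m Hm] : exists n, forall m, (n <= m)%N -> delta ^+ m < sigma / B.
  by apply: expr_eventually_lt; rewrite ?divr_gt0 // ltW.
(* The index is [m.+1] rather than [m] because trials are numbered from 1. *)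
have dm : 0 < delta ^+ m.+1 <= 1 by rewrite exprn_gt0 ?exprn_ile1 // ltW.
exists (1 - delta ^+ m.+1); first lra.
move=> x t x' t' /andP[t0 t1] Xx gtx [n [w [n1 wout wpos wn [-> ->]]]].
have dk k : 0 <= delta ^+ k <= 1 by rewrite exprn_ge0 ?exprn_ile1 // ltW.
have trial01 k : 0 <= t * (1 - delta ^+ k) <= 1.
  have := dk k => /andP[? ?]; rewrite mulr_ge0 ?mulr_ile1 //; lra.
have trial k : t * (1 - delta ^+ k) - t = - (t * delta ^+ k) by ring.
have nm : (n <= m.+1)%N.
  rewrite leqNgt; apply/negP => mn; have := wpos m.+1; rewrite mn => /(_ isT).
  have small : `|t * (1 - delta ^+ m.+1) - t| * B <= sigma.
    rewrite trial normrN ger0_norm ?mulr_ge0 ?exprn_ge0 ?(ltW d0) //.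
    rewrite -ler_pdivlMr //; apply: le_trans (ltW (Hm m.+1 (leqnSn m))).
    by rewrite ler_piMl // exprn_ge0 // ltW.
  have [_] := trial_success (trial01 _) small Xx gtx (wout m.+1 (ltnW mn)).
  by rewrite -/(g _) => ->; rewrite ltxx.
(* The accepted trial may come before [trial_success] applies. Its value is 0 by the acceptance
   test, so only membership in [X] is needed from the method. *)
have [L [alpha [z [[L0 gL] aL z0 zstep zw]]]] :
    prox_grad_output (g (t * (1 - delta ^+ n))) X x (w n).
  by apply: wout; rewrite n1 leqnn.
have [_ [K gK]] := exists_gap_zero_expansion cX X0 convX l0
  (affine_homotopy_map H (t * (1 - delta ^+ n)) affF).
have Xz0 : X (z 0%N) by rewrite z0.
have closedX : closed X by apply: compact_closed.
have [Xw _ _] := prox_grad_limit convX closedX gK L0 gL aL Xz0 zstep zw.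
split=> //; have /andP[-> _] := trial01 n; rewrite mulrC ler_wpM2r //.
have : delta ^+ m.+1 <= delta ^+ n by rewrite ler_wiXn2l // ltW.
lra.
Qed.

Lemma homotopy_run_bound x t : homotopy_run lambda delta H F X x t ->
  exists2 q : R, 0 <= q < 1 & forall k, [/\ X (x k), g (t k) (x k) = 0 & 0 <= t k <= q ^+ k].
Proof.
move=> [t0 VI0 step]; have [q q01 qstep] := homotopy_step_contraction.
exists q => //; elim=> [|k [Xx gx /andP[tk0 tk]]].
  have Xx0 := VI0.1; rewrite t0 expr0 ler01 lexx; split=> //.
  by rewrite /g -[in LHS]t0 VI_gap_eq0.
have /andP[q0 q1] := q01.
have tk1 : 0 <= t k <= 1 by rewrite tk0 (le_trans tk) // exprn_ile1 // ltW.
have [XSk gSk /andP[tSk tq]] := qstep _ _ _ _ tk1 Xx gx (step k).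
by split=> //; rewrite tSk (le_trans tq) // exprS ler_wpM2l.
Qed.

(** If the inequality failed at [y] with value [- 2 * e], it would fail by more than [e] near
    [xstar]. But a late iterate close to [xstar] solves the problem for [F] perturbed by
    [t k *: (H - F)], which costs at most [t k * B <= e]. *)
Lemma homotopy_run_cluster x t xstar : homotopy_run lambda delta H F X x t ->
  cluster (x @ \oo) xstar -> VI_solution F X xstar.
Proof.
move=> run xcl; have [q q01 xP] := homotopy_run_bound run.
have [c c0 Fc] := affine_linear_lipschitz affF.
have Fcont : continuous F by exact: (@lipschitz_continuous R 'rV[R]_d 'rV[R]_d F c).
have tail n : (x @ \oo) [set x k | k in [set k | (n <= k)%N]].
  by exists n => // k /= nk; exists k.
have Xs : X xstar.
  have closedX : closed X by apply: compact_closed.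
  apply: closedX => U /(xcl _ _ (tail 0%N))[_ [[k _ <-] Uk]].
  by exists (x k); split=> //; have [] := xP k.
split=> // y Xy; rewrite leNgt; apply/negP => neg.
pose e := - dotv (F xstar) (y - xstar) / 2.
have e0 : 0 < e by rewrite divr_gt0 // oppr_gt0.
have [n qn] := expr_eventually_lt q01 (divr_gt0 e0 B0).
have psi_cont : dotv (F z) (y - z) @[z --> xstar] --> dotv (F xstar) (y - xstar).
  apply: (dotv_cvg (Fcont xstar)).
  exact: (@cvgB R 'rV[R]_d _ _ _ (fun=> y) id _ _ (cvg_cst _) (@cvg_id _ (nbhs xstar))).
have near_neg : nbhs xstar [set z | dotv (F z) (y - z) < - e].
  apply: (cvgr_lt _ psi_cont); rewrite /e; lra.
have [_ [[k /= nk <-] xk]] := xcl _ _ (tail n) near_neg.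
have [Xx gx /andP[tk0 tk]] := xP k.
have [_ /(_ y Xy)] := gap_eq0_VI cX X0 convX Xx gx.
rewrite (_ : homotopy_map H F (t k) (x k) = t k *: (H (x k) - F (x k)) + F (x k)); last first.
  by apply/rowP => i; rewrite !mxE; ring.
rewrite dotvDl dotvZl -(opprB (x k) y) dotvNr (opprB (x k) y).
have := HFB Xx Xy; rewrite ler_norml => /andP[Hk _].
have tB : t k * B <= e.
  by rewrite -ler_pdivlMr // (le_trans tk) // ltW // qn.
have : t k * - dotv (H (x k) - F (x k)) (x k - y) <= t k * B.
  by rewrite ler_wpM2l // lerNl.
move: xk => /=; lra.
Qed.

End HomotopyContinuation.

Theorem theorem4 (R : realType) (d : nat)
    (H : {linear 'rV[R]_d -> 'rV[R]_d}) (F : 'rV[R]_d -> 'rV[R]_d)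
    (X : set 'rV[R]_d) (lambda delta sigma : R)
    (x : nat -> 'rV[R]_d) (t : nat -> R) (xstar : 'rV[R]_d) :
  strongly_monotone H ->
  affine_linear F ->
  polyhedron X -> bounded_set X ->
  0 < lambda ->
  0 < delta < 1 ->
  0 < sigma ->
  (forall s : R, 0 <= s <= 1 ->
     critical_gap sigma (gap lambda (homotopy_map H F s) X) X) ->
  homotopy_run lambda delta H F X x t ->
  cluster (x @ \oo) xstar ->
  VI_solution F X xstar.
Proof.
move=> _ affF polX bX l0 delta01 sigma0 gapX run.
have cX := bounded_closed_compact bX (polyhedron_closed polX).
have X0 : X !=set0 by exists (x 0%N); have [_ [Xx _] _] := run.
have convX := polyhedron_convex polX.
have [M [_ XM]] := bX; have {}XM z : X z -> `|z| <= `|M| + 1.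
  by apply: XM; rewrite (le_lt_trans (ler_norm M)) // ltrDl.
have [c c0 Fc] := affine_linear_lipschitz affF; have [k k0 Hk] := linear_bounded H.
pose D := (k + c) * (`|M| + 1) + `|F 0|.
have D0 : 0 <= D by rewrite addr_ge0 // mulr_ge0 // addr_ge0.
(* [D] bounds [H - F] on [X] and [2 * (|M| + 1)] bounds differences of points of [X]; [d] comes from
   [dotv_norm_le], and the final 1 makes [B] positive. *)
pose B := d%:R * (D * (2 * (`|M| + 1))) + 1.
have B0 : 0 < B by rewrite ltr_wpDl // !mulr_ge0 // addr_ge0.
apply: (@homotopy_run_cluster R d H F X lambda delta sigma B) run => //.
move=> z w Xz Xw; apply: (le_trans (dotv_norm_le _ _)).
rewrite ler_wpDr // ler_wpM2l // ler_pM //.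
  have := Fc z 0; have := Hk z; rewrite subr0 => Hz Fz.
  have : `|H z - F z| <= `|H z| + (`|F z - F 0| + `|F 0|).
    by rewrite (le_trans (ler_normB _ _)) // lerD2l -{1}[F z](subrK (F 0)) ler_normD.
  have : (k + c) * `|z| <= (k + c) * (`|M| + 1) by rewrite ler_wpM2l ?XM // addr_ge0.
  rewrite /D; lra.
rewrite (le_trans (ler_normB _ _)) //; have := XM _ Xz; have := XM _ Xw; lra.
Qed.
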